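(* Let $\sharp\in\{b,d,v,s\}$ and let $\mathcal T$ be a triangulated category (a strongly triangulated category if $\sharp=s$). Any element in $K_1({}^\sharp\mathcal T)$ is represented by a pair of $\sharp$-triangles: for every $x\in K_1({}^\sharp\mathcal T)$ there are two $\sharp$-triangles on the same objects $X\xrightarrow{f}Y\xrightarrow{i}Z\xrightarrow{q}\Sigma X$ and $X\xrightarrow{f'}Y\xrightarrow{i'}Z\xrightarrow{q'}\Sigma X$ such that $$x=-[X\xrightarrow{f}Y\xrightarrow{i}Z\xrightarrow{q}\Sigma X]+[X\xrightarrow{f'}Y\xrightarrow{i'}Z\xrightarrow{q'}\Sigma X]$$ in $\pi_1\mathcal D_*({}^\sharp\mathcal T)\cong K_1({}^\sharp\mathcal T)$.
   Context: Stable quadratic modules. Groups are additive, $[x,y]=-x-y+x+y$. A stable quadratic module $C_*$ consists of homomorphisms $C_0^{ab}\otimes C_0^{ab}\xrightarrow{\langle\cdot,\cdot\rangle}C_1\xrightarrow{\partial}C_0$ with $\langle c_0,c_0'\rangle+\langle c_0',c_0\rangle=0$, $\partial\langle c_0,c_0'\rangle=[c_0',c_0]$, $\langle\partial c_1,\partial c_1'\rangle=[c_1',c_1]$; $C_0$ acts on $C_1$ by $c_1^{c_0}=c_1+\langle c_0,\partial c_1\rangle$; $\pi_0C_*=C_0/\partial C_1$, $\pi_1C_*=\ker\partial$. Morphisms are pairs of homomorphisms compatible with $\partial$ and the bracket; presentations by generators in degrees $0,1$ and relations have the evident universal property. Triangles. $\mathcal T$ has suspension $\Sigma$ and chosen zero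 object $0$. A triangle is $X\xrightarrow fY\xrightarrow iC\xrightarrow q\Sigma X$ with consecutive composites (also $(\Sigma f)q$) zero. An octahedral diagram on $X\xrightarrow fY\xrightarrow gZ$ consists of triangles $\Delta_f\colon X\xrightarrow{f}Y\xrightarrow{i^f}C^f\xrightarrow{q^f}\Sigma X$, $\Delta_g\colon Y\xrightarrow{g}Z\xrightarrow{i^g}C^g\xrightarrow{q^g}\Sigma Y$, $\Delta_{gf}\colon X\xrightarrow{gf}Z\xrightarrow{i^{gf}}C^{gf}\xrightarrow{q^{gf}}\Sigma X$, $\widetilde\Delta\colon C^f\xrightarrow{\bar g}C^{gf}\xrightarrow{\bar f}C^g\xrightarrow{(\Sigma i^f)q^g}\Sigma C^f$ with $\bar g i^f=i^{gf}g$, $q^{gf}\bar g=q^f$, $\bar f i^{gf}=i^g$, $q^g\bar f=(\Sigma f)q^{gf}$. It is an (ordinary) octahedron if all four triangles are distinguished; special if moreover $Y\xrightarrow{(g,-i^f)}Z\oplus C^f\xrightarrow{(i^{gf},\bar g)}C^{gf}\xrightarrow{q^g\bar f}\Sigma Y$ and $C^{gf}\xrightarrow{(q^{gf},-\bar f)}\Sigma X\oplus C^g\xrightarrow{(\Sigma f,q^g)}\Sigma Y\xrightarrow{\Sigma(\bar g i^f)}\Sigma C^{gf}$ are distinguished. Contractible triangles are direct sums of triangles $A\xrightarrow1A\to0\to\Sigma A$, $0\to B\xrightarrow1B\to0$, $C\to0\to\Sigma C\xrightarrow1\Sigma C$. A triangle is virtual if its sum with some contractible triangle is isomorphic to some $(f',i',q')$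 such that there are distinguished triangles $(f'',i',q')$, $(f',i'',q')$, $(f',i',q'')$ on the same objects. A virtual octahedron is an octahedral diagram whose four triangles are virtual. A strongly triangulated category (Maltsiniotis) is a triangulated category with distinguished $n$-triangles for all $n$ satisfying axioms generalizing those for distinguished triangles; only its distinguished octahedra ($3$-triangles) matter here: a family of octahedra closed under isomorphisms and finite direct sums, containing degenerate octahedra, such that every composable pair completes to a distinguished octahedron, and morphisms between bases extend. A $\sharp$-triangle is a distinguished triangle if $\sharp=b,d,s$ and a virtual triangle if $\sharp=v$; a $\sharp$-octahedron is an ordinary, special, virtual, distinguished octahedron for $\sharp=b,d,v,s$ respectively. $\mathcal D_*({}^\sharp\mathcal T)$ is presented by generators $[X]$ (degree $0$) for each object, $[h]$ (degree $1$) for each isomorphism $h\colon X\to X'$, $[\Delta]$ (degree $1$) for each $\sharp$-triangle $\Delta=(X\to Y\to C\to\Sigma X)$, and relations: $\partial[h]=-[X']+[X]$; $\partial[\Delta]=-[Y]+[C]+[X]$; $[0]=0$; $[1_X]=0$; $[X\xrightarrow1X\to0\to\Sigma X]=0=[0\to X\xrightarrow1X\to0]$; $[kh]=[k]+[h]$; $[a]+[c]^{[X]}=-[\Delta']+[b]+[\Delta]$ for each isomorphism $(a,b,c)\colon\Delta\to\Delta'$ of $\sharp$-triangles; $[\Delta_g]+[\Delta_f]=[\Delta_{gf}]+[\widetilde\Delta]^{[X]}$ for each $\sharp$-octahedron; $\langle[X],[Y]\rangle=-[\Delta_2]+[\Delta_1]$ with $\Delta_1\colon X\to X\oplus Y\to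 Y\xrightarrow0\Sigma X$, $\Delta_2\colon Y\to X\oplus Y\to X\xrightarrow0\Sigma Y$ given by inclusions and projections. $K_1({}^\sharp\mathcal T)$ is identified with $\pi_1\mathcal D_*({}^\sharp\mathcal T)$ (this is Breuning's definition for $\sharp=b$, and is canonically isomorphic to the first homotopy group of Neeman's, resp. Maltsiniotis's, $K$-theory spectrum for $\sharp=d,v$, resp. $s$). *)

(* Defs.v *)
From HB Require Import structures.
From mathcomp Require Import all_boot generic_quotient all_algebra.
From mathcomp.classical Require Import boolp.

Set Implicit Arguments.
Unset Strict Implicit.
Unset Printing Implicit Defensive.

Import GRing.Theory.

(* The two groups are possibly infinite and non-commutative, so they are
   MathComp [groupType]s, written multiplicatively: x + y, - x and 0 of the
   additive convention are x * y, x^-1 and 1, and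
   [~ x, y] = x^-1 * y^-1 * x * y is [x, y] = - x - y + x + y.
   A homomorphism from the tensor square of the abelianization of C0 is the
   same as a map C0 -> C0 -> C1 that is multiplicative in each variable (its
   values then commute with each other, so it factors through C0^ab). *)
Record stableQuadraticModule := StableQuadraticModule {
  sqm0 : groupType;
  sqm1 : groupType;
  bd : sqm1 -> sqm0;
  br : sqm0 -> sqm0 -> sqm1;
  bdM : {morph bd : x y / (x * y)%g};
  brMl : forall c, {morph br^~ c : a b / (a * b)%g};
  brMr : forall c, {morph br c : a b / (a * b)%g};
  br_skew : forall a b, (br a b * br b a = 1)%g;
  bd_br : forall a b, bd (br a b) = [~ b, a]%g;
  br_bd : forall x y, br (bd x) (bd y) = [~ y, x]%g
}.

Arguments bd {s} _.
Arguments br {s} _ _.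

Definition pi1 (C : stableQuadraticModule) := {x : sqm1 C | bd x == 1%g}.

Record sqmMorphism (C D : stableQuadraticModule) := SqmMorphism {
  mor0 : sqm0 C -> sqm0 D;
  mor1 : sqm1 C -> sqm1 D;
  mor0M : {morph mor0 : x y / (x * y)%g};
  mor1M : {morph mor1 : x y / (x * y)%g};
  mor_bd : forall x, bd (mor1 x) = mor0 (bd x);
  mor_br : forall a b, br (mor0 a) (mor0 b) = mor1 (br a b)
}.

Inductive word0 (G0 G1 : Type) : Type :=
| Gen0 of G0
| Zero0
| Add0 of word0 G0 G1 & word0 G0 G1
| Opp0 of word0 G0 G1
| Bd of word1 G0 G1
with word1 (G0 G1 : Type) : Type :=
| Gen1 of G1
| Zero1
| Add1 of word1 G0 G1 & word1 G0 G1
| Opp1 of word1 G0 G1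
| Br of word0 G0 G1 & word0 G0 G1.

Arguments Gen0 {G0 G1} _.
Arguments Zero0 {G0 G1}.
Arguments Add0 {G0 G1} _ _.
Arguments Opp0 {G0 G1} _.
Arguments Bd {G0 G1} _.
Arguments Gen1 {G0 G1} _.
Arguments Zero1 {G0 G1}.
Arguments Add1 {G0 G1} _ _.
Arguments Opp1 {G0 G1} _.
Arguments Br {G0 G1} _ _.

Declare Scope word0_scope.
Delimit Scope word0_scope with W0.
Bind Scope word0_scope with word0.
Declare Scope word1_scope.
Delimit Scope word1_scope with W1.
Bind Scope word1_scope with word1.

Notation "0" := Zero0 : word0_scope.
Notation "x + y" := (Add0 x y) : word0_scope.
Notation "- x" := (Opp0 x) : word0_scope.
Notation "0" := Zero1 : word1_scope.
Notation "x + y" := (Add1 x y) : word1_scope.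
Notation "- x" := (Opp1 x) : word1_scope.

Definition comm0 G0 G1 (x y : word0 G0 G1) : word0 G0 G1 :=
  (- x + - y + x + y)%W0.
Definition comm1 G0 G1 (x y : word1 G0 G1) : word1 G0 G1 :=
  (- x + - y + x + y)%W1.

(* The action of degree 0 on degree 1: x^a = x + <a, bd x>. *)
Definition actw G0 G1 (x : word1 G0 G1) (a : word0 G0 G1) : word1 G0 G1 :=
  (x + Br a (Bd x))%W1.

Record sqmPresentation := SqmPresentation {
  gen0 : Type;
  gen1 : Type;
  rel0 : word0 gen0 gen1 -> word0 gen0 gen1 -> Prop;
  rel1 : word1 gen0 gen1 -> word1 gen0 gen1 -> Prop
}.

(* The congruence on words generated by the relations of a presentation and
   the axioms of stable quadratic modules. *)
Inductive cong0 (P : sqmPresentation) :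
  word0 (gen0 P) (gen1 P) -> word0 (gen0 P) (gen1 P) -> Prop :=
| cong0_rel u v : rel0 u v -> cong0 u v
| cong0_refl u : cong0 u u
| cong0_sym u v : cong0 u v -> cong0 v u
| cong0_trans u v w : cong0 u v -> cong0 v w -> cong0 u w
| cong0_add u u' v v' : cong0 u u' -> cong0 v v' -> cong0 (u + v) (u' + v')
| cong0_opp u u' : cong0 u u' -> cong0 (- u) (- u')
| cong0_bd x x' : cong1 x x' -> cong0 (Bd x) (Bd x')
| cong0_addA u v w : cong0 (u + (v + w)) (u + v + w)
| cong0_add0l u : cong0 (0 + u) u
| cong0_add0r u : cong0 (u + 0) u
| cong0_addNl u : cong0 (- u + u) 0
| cong0_addNr u : cong0 (u + - u) 0
| cong0_bdD x y : cong0 (Bd (x + y)) (Bd x + Bd y)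
| cong0_bd_br u v : cong0 (Bd (Br u v)) (comm0 v u)
with cong1 (P : sqmPresentation) :
  word1 (gen0 P) (gen1 P) -> word1 (gen0 P) (gen1 P) -> Prop :=
| cong1_rel x y : rel1 x y -> cong1 x y
| cong1_refl x : cong1 x x
| cong1_sym x y : cong1 x y -> cong1 y x
| cong1_trans x y z : cong1 x y -> cong1 y z -> cong1 x z
| cong1_add x x' y y' : cong1 x x' -> cong1 y y' -> cong1 (x + y) (x' + y')
| cong1_opp x x' : cong1 x x' -> cong1 (- x) (- x')
| cong1_br u u' v v' : cong0 u u' -> cong0 v v' -> cong1 (Br u v) (Br u' v')
| cong1_addA x y z : cong1 (x + (y + z)) (x + y + z)
| cong1_add0l x : cong1 (0 + x) x
| cong1_add0r x : cong1 (x + 0) x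
| cong1_addNl x : cong1 (- x + x) 0
| cong1_addNr x : cong1 (x + - x) 0
| cong1_brDl u v w : cong1 (Br (u + v) w) (Br u w + Br v w)
| cong1_brDr u v w : cong1 (Br u (v + w)) (Br u v + Br u w)
| cong1_br_skew u v : cong1 (Br u v + Br v u) 0
| cong1_br_bd x y : cong1 (Br (Bd x) (Bd y)) (comm1 y x).

Section PresentedModule.

Local Open Scope quotient_scope.

Variable P : sqmPresentation.

Local Notation W0 := {classic word0 (gen0 P) (gen1 P)}.
Local Notation W1 := {classic word1 (gen0 P) (gen1 P)}.

Definition congb0 : rel W0 := fun u v => `[< cong0 u v >].
Definition congb1 : rel W1 := fun x y => `[< cong1 x y >].

Fact congb0_equiv : equiv_class_of congb0.
Proof.
split; first by move=> u; apply/asboolP/cong0_refl.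
  by move=> u v; apply/asboolP/asboolP; apply: cong0_sym.
by move=> v u w /asboolP uv /asboolP vw; apply/asboolP/(cong0_trans uv).
Qed.

Fact congb1_equiv : equiv_class_of congb1.
Proof.
split; first by move=> u; apply/asboolP/cong1_refl.
  by move=> u v; apply/asboolP/asboolP; apply: cong1_sym.
by move=> v u w /asboolP uv /asboolP vw; apply/asboolP/(cong1_trans uv).
Qed.

Canonical congb0_equiv_rel := EquivRelPack congb0_equiv.
Canonical congb1_equiv_rel := EquivRelPack congb1_equiv.

Definition pres0 := {eq_quot congb0}.
Definition pres1 := {eq_quot congb1}.
HB.instance Definition _ := Choice.on pres0.
HB.instance Definition _ := Choice.on pres1.

Definition cls0 (u : word0 (gen0 P) (gen1 P)) : pres0 :=
  \pi_{eq_quot congb0} (u : W0).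
Definition cls1 (x : word1 (gen0 P) (gen1 P)) : pres1 :=
  \pi_{eq_quot congb1} (x : W1).
Definition rep0 (a : pres0) : word0 (gen0 P) (gen1 P) :=
  repr (a : {eq_quot congb0}).
Definition rep1 (x : pres1) : word1 (gen0 P) (gen1 P) :=
  repr (x : {eq_quot congb1}).

Lemma cls0P u v : cls0 u = cls0 v <-> cong0 u v.
Proof. by split=> [/eqmodP/asboolP //|?]; apply/eqmodP/asboolP. Qed.

Lemma cls1P x y : cls1 x = cls1 y <-> cong1 x y.
Proof. by split=> [/eqmodP/asboolP //|?]; apply/eqmodP/asboolP. Qed.

Lemma rep0K : cancel rep0 cls0. Proof. exact: reprK. Qed.
Lemma rep1K : cancel rep1 cls1. Proof. exact: reprK. Qed.

Lemma rep0P u : cong0 (rep0 (cls0 u)) u.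
Proof. by apply/cls0P; rewrite rep0K. Qed.

Lemma rep1P x : cong1 (rep1 (cls1 x)) x.
Proof. by apply/cls1P; rewrite rep1K. Qed.

Definition pres0_mul (a b : pres0) := cls0 (rep0 a + rep0 b).
Definition pres0_inv (a : pres0) := cls0 (- rep0 a).
Definition pres1_mul (x y : pres1) := cls1 (rep1 x + rep1 y).
Definition pres1_inv (x : pres1) := cls1 (- rep1 x).
Definition pres_bd (x : pres1) : pres0 := cls0 (Bd (rep1 x)).
Definition pres_br (a b : pres0) : pres1 := cls1 (Br (rep0 a) (rep0 b)).

Lemma cls0D u v : cls0 (u + v) = pres0_mul (cls0 u) (cls0 v).
Proof. by apply/cls0P/cong0_sym; apply: cong0_add; apply: rep0P. Qed.
Lemma cls0N u : cls0 (- u) = pres0_inv (cls0 u).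
Proof. by apply/cls0P/cong0_sym; apply: cong0_opp; apply: rep0P. Qed.
Lemma cls1D x y : cls1 (x + y) = pres1_mul (cls1 x) (cls1 y).
Proof. by apply/cls1P/cong1_sym; apply: cong1_add; apply: rep1P. Qed.
Lemma cls1N x : cls1 (- x) = pres1_inv (cls1 x).
Proof. by apply/cls1P/cong1_sym; apply: cong1_opp; apply: rep1P. Qed.
Lemma cls0_bd x : cls0 (Bd x) = pres_bd (cls1 x).
Proof. by apply/cls0P/cong0_sym; apply: cong0_bd; apply: rep1P. Qed.
Lemma cls1_br u v : cls1 (Br u v) = pres_br (cls0 u) (cls0 v).
Proof. by apply/cls1P/cong1_sym; apply: cong1_br; apply: rep0P. Qed.

Fact pres0_mulA : associative pres0_mul.
Proof.
move=> a b c; rewrite -[a]rep0K -[b]rep0K -[c]rep0K -!cls0D.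
exact/cls0P/cong0_addA.
Qed.
Fact pres0_mul1 : left_id (cls0 0) pres0_mul.
Proof. by move=> a; rewrite -[a]rep0K -cls0D; apply/cls0P/cong0_add0l. Qed.
Fact pres0_1mul : right_id (cls0 0) pres0_mul.
Proof. by move=> a; rewrite -[a]rep0K -cls0D; apply/cls0P/cong0_add0r. Qed.
Fact pres0_mulV : left_inverse (cls0 0) pres0_inv pres0_mul.
Proof. by move=> a; rewrite -[a]rep0K -cls0N -cls0D; apply/cls0P/cong0_addNl. Qed.
Fact pres0_Vmul : right_inverse (cls0 0) pres0_inv pres0_mul.
Proof. by move=> a; rewrite -[a]rep0K -cls0N -cls0D; apply/cls0P/cong0_addNr. Qed.

HB.instance Definition _ := isGroup.Build pres0
  pres0_mulA pres0_mul1 pres0_1mul pres0_mulV pres0_Vmul.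

Fact pres1_mulA : associative pres1_mul.
Proof.
move=> a b c; rewrite -[a]rep1K -[b]rep1K -[c]rep1K -!cls1D.
exact/cls1P/cong1_addA.
Qed.
Fact pres1_mul1 : left_id (cls1 0) pres1_mul.
Proof. by move=> a; rewrite -[a]rep1K -cls1D; apply/cls1P/cong1_add0l. Qed.
Fact pres1_1mul : right_id (cls1 0) pres1_mul.
Proof. by move=> a; rewrite -[a]rep1K -cls1D; apply/cls1P/cong1_add0r. Qed.
Fact pres1_mulV : left_inverse (cls1 0) pres1_inv pres1_mul.
Proof. by move=> a; rewrite -[a]rep1K -cls1N -cls1D; apply/cls1P/cong1_addNl. Qed.
Fact pres1_Vmul : right_inverse (cls1 0) pres1_inv pres1_mul.
Proof. by move=> a; rewrite -[a]rep1K -cls1N -cls1D; apply/cls1P/cong1_addNr. Qed.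

HB.instance Definition _ := isGroup.Build pres1
  pres1_mulA pres1_mul1 pres1_1mul pres1_mulV pres1_Vmul.

Lemma cls0_mul u v : cls0 (u + v) = (cls0 u * cls0 v)%g.
Proof. exact: cls0D. Qed.
Lemma cls0_inv u : cls0 (- u) = ((cls0 u)^-1)%g.
Proof. exact: cls0N. Qed.
Lemma cls1_mul x y : cls1 (x + y) = (cls1 x * cls1 y)%g.
Proof. exact: cls1D. Qed.
Lemma cls1_inv x : cls1 (- x) = ((cls1 x)^-1)%g.
Proof. exact: cls1N. Qed.

Lemma cls0_comm u v : cls0 (comm0 u v) = [~ cls0 u, cls0 v]%g.
Proof. by rewrite /comm0 !cls0_mul !cls0_inv /commg -!mulgA. Qed.
Lemma cls1_comm x y : cls1 (comm1 x y) = [~ cls1 x, cls1 y]%g.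
Proof. by rewrite /comm1 !cls1_mul !cls1_inv /commg -!mulgA. Qed.

Fact pres_bdM : {morph pres_bd : x y / (x * y)%g}.
Proof.
move=> x y; rewrite -[x]rep1K -[y]rep1K -cls1_mul -!cls0_bd -cls0_mul.
exact/cls0P/cong0_bdD.
Qed.

Fact pres_brMl c : {morph pres_br^~ c : a b / (a * b)%g}.
Proof.
move=> a b; rewrite -[a]rep0K -[b]rep0K -[c]rep0K -cls0_mul -!cls1_br -cls1_mul.
exact/cls1P/cong1_brDl.
Qed.

Fact pres_brMr c : {morph pres_br c : a b / (a * b)%g}.
Proof.
move=> a b; rewrite -[a]rep0K -[b]rep0K -[c]rep0K -cls0_mul -!cls1_br -cls1_mul.
exact/cls1P/cong1_brDr.
Qed.

Fact pres_br_skew a b : (pres_br a b * pres_br b a = 1)%g.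
Proof.
rewrite -[a]rep0K -[b]rep0K -!cls1_br -cls1_mul.
exact/cls1P/cong1_br_skew.
Qed.

Fact pres_bd_br a b : pres_bd (pres_br a b) = [~ b, a]%g.
Proof.
rewrite -[a]rep0K -[b]rep0K -cls1_br -cls0_bd -cls0_comm.
exact/cls0P/cong0_bd_br.
Qed.

Fact pres_br_bd x y : pres_br (pres_bd x) (pres_bd y) = [~ y, x]%g.
Proof.
rewrite -[x]rep1K -[y]rep1K -!cls0_bd -cls1_br -cls1_comm.
exact/cls1P/cong1_br_bd.
Qed.

Definition presentedSqm : stableQuadraticModule :=
  StableQuadraticModule pres_bdM pres_brMl pres_brMr
    pres_br_skew pres_bd_br pres_br_bd.

End PresentedModule.

Section Evaluation.

Variables (G0 G1 : Type) (C : stableQuadraticModule).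
Variables (e0 : G0 -> sqm0 C) (e1 : G1 -> sqm1 C).

Fixpoint eval0 (u : word0 G0 G1) : sqm0 C :=
  match u with
  | Gen0 g => e0 g
  | Zero0 => 1%g
  | Add0 u v => (eval0 u * eval0 v)%g
  | Opp0 u => ((eval0 u)^-1)%g
  | Bd x => bd (eval1 x)
  end
with eval1 (x : word1 G0 G1) : sqm1 C :=
  match x with
  | Gen1 g => e1 g
  | Zero1 => 1%g
  | Add1 x y => (eval1 x * eval1 y)%g
  | Opp1 x => ((eval1 x)^-1)%g
  | Br u v => br (eval0 u) (eval0 v)
  end.

End Evaluation.

Scheme word0_mut := Induction for word0 Sort Prop
with word1_mut := Induction for word1 Sort Prop.
Combined Scheme word_mut from word0_mut, word1_mut.

Scheme cong0_mut := Minimality for cong0 Sort Prop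
with cong1_mut := Minimality for cong1 Sort Prop.
Combined Scheme cong_mut from cong0_mut, cong1_mut.

Section UniversalProperty.

Variables (P : sqmPresentation) (C : stableQuadraticModule).
Variables (e0 : gen0 P -> sqm0 C) (e1 : gen1 P -> sqm1 C).

Definition satisfies : Prop :=
  (forall u v, rel0 u v -> eval0 e0 e1 u = eval0 e0 e1 v) /\
  (forall x y, rel1 x y -> eval1 e0 e1 x = eval1 e0 e1 y).

Lemma eval_cong : satisfies ->
  (forall u v, @cong0 P u v -> eval0 e0 e1 u = eval0 e0 e1 v) /\
  (forall x y, @cong1 P x y -> eval1 e0 e1 x = eval1 e0 e1 y).
Proof.
move=> [sat0 sat1]; apply: cong_mut => //=; try congruence.
- by move=> *; rewrite mulgA.
- by move=> *; rewrite mul1g.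
- by move=> *; rewrite mulg1.
- by move=> *; rewrite mulVg.
- by move=> *; rewrite mulgV.
- by move=> *; rewrite bdM.
- by move=> *; rewrite bd_br /commg -!mulgA.
- by move=> *; rewrite mulgA.
- by move=> *; rewrite mul1g.
- by move=> *; rewrite mulg1.
- by move=> *; rewrite mulVg.
- by move=> *; rewrite mulgV.
- by move=> *; rewrite brMl.
- by move=> *; rewrite brMr.
- by move=> *; rewrite br_skew.
- by move=> *; rewrite br_bd /commg -!mulgA.
Qed.

Theorem presentedSqm_universal : satisfies ->
  exists F : sqmMorphism (presentedSqm P) C,
    ((forall g, mor0 F (cls0 (Gen0 g)) = e0 g) /\
     (forall g, mor1 F (cls1 (Gen1 g)) = e1 g)) /\
    forall F' : sqmMorphism (presentedSqm P) C,
      (forall g, mor0 F' (cls0 (Gen0 g)) = e0 g) ->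
      (forall g, mor1 F' (cls1 (Gen1 g)) = e1 g) ->
      mor0 F' =1 mor0 F /\ mor1 F' =1 mor1 F.
Proof.
move=> sat; have [ev0 ev1] := eval_cong sat.
pose m0 (a : pres0 P) := eval0 e0 e1 (rep0 a).
pose m1 (x : pres1 P) := eval1 e0 e1 (rep1 x).
have m0E u : m0 (cls0 u) = eval0 e0 e1 u by apply: ev0; apply: rep0P.
have m1E x : m1 (cls1 x) = eval1 e0 e1 x by apply: ev1; apply: rep1P.
have m0M : {morph m0 : a b / (a * b)%g}.
  by move=> a b; rewrite -[a]rep0K -[b]rep0K -cls0_mul !m0E.
have m1M : {morph m1 : a b / (a * b)%g}.
  by move=> a b; rewrite -[a]rep1K -[b]rep1K -cls1_mul !m1E.
have m_bd (x : sqm1 (presentedSqm P)) : bd (m1 x) = m0 (bd x).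
  by rewrite -[x]rep1K m1E /= -cls0_bd m0E.
have m_br (a b : sqm0 (presentedSqm P)) : br (m0 a) (m0 b) = m1 (br a b).
  by rewrite -[a]rep0K -[b]rep0K !m0E /= -cls1_br m1E.
exists (@SqmMorphism (presentedSqm P) C m0 m1 m0M m1M m_bd m_br) => /=.
split; first by split=> g; rewrite ?m0E ?m1E.
case=> n0 n1 n0M n1M n_bd n_br /= n0g n1g.
have n01 : n0 (cls0 Zero0) = 1%g.
  apply: (mulgI (n0 (cls0 Zero0))); rewrite mulg1 -n0M -cls0_mul; congr n0.
  exact/cls0P/cong0_add0l.
have n11 : n1 (cls1 Zero1) = 1%g.
  apply: (mulgI (n1 (cls1 Zero1))); rewrite mulg1 -n1M -cls1_mul; congr n1.
  exact/cls1P/cong1_add0l.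
have [E0 E1] : (forall u, n0 (cls0 u) = eval0 e0 e1 u) /\
               (forall x, n1 (cls1 x) = eval1 e0 e1 x).
  apply: word_mut => //=.
  - by move=> u Eu v Ev; rewrite cls0_mul n0M Eu Ev.
  - move=> u Eu; apply: (mulIg (n0 (cls0 u))); rewrite -n0M -cls0_mul Eu mulVg -n01.
    by congr n0; apply/cls0P/cong0_addNl.
  - by move=> x Ex; rewrite cls0_bd -[LHS]n_bd Ex.
  - by move=> x Ex y Ey; rewrite cls1_mul n1M Ex Ey.
  - move=> x Ex; apply: (mulIg (n1 (cls1 x))); rewrite -n1M -cls1_mul Ex mulVg -n11.
    by congr n1; apply/cls1P/cong1_addNl.
  - by move=> u Eu v Ev; rewrite cls1_br -[LHS]n_br Eu Ev.
by split=> [a|x]; [rewrite -[a]rep0K E0 m0E | rewrite -[x]rep1K E1 m1E].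
Qed.

End UniversalProperty.

Local Open Scope ring_scope.

Record additiveCategory := AdditiveCategory {
  ob :> Type;
  arr : ob -> ob -> zmodType;
  idm : forall X, arr X X;
  compose : forall X Y Z, arr Y Z -> arr X Y -> arr X Z;
  compA : forall W X Y Z (h : arr Y Z) (g : arr X Y) (f : arr W X),
    compose h (compose g f) = compose (compose h g) f;
  comp1m : forall X Y (f : arr X Y), compose (idm Y) f = f;
  compm1 : forall X Y (f : arr X Y), compose f (idm X) = f;
  compDl : forall X Y Z (g g' : arr Y Z) (f : arr X Y),
    compose (g + g') f = compose g f + compose g' f;
  compDr : forall X Y Z (g : arr Y Z) (f f' : arr X Y),
    compose g (f + f') = compose g f + compose g f';
  zob : ob;
  idm_zob : idm zob = 0;
  dsum : ob -> ob -> ob;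
  incl1 : forall X Y, arr X (dsum X Y);
  incl2 : forall X Y, arr Y (dsum X Y);
  prj1 : forall X Y, arr (dsum X Y) X;
  prj2 : forall X Y, arr (dsum X Y) Y;
  prj1_incl1 : forall X Y, compose (prj1 X Y) (incl1 X Y) = idm X;
  prj2_incl2 : forall X Y, compose (prj2 X Y) (incl2 X Y) = idm Y;
  prj1_incl2 : forall X Y, compose (prj1 X Y) (incl2 X Y) = 0;
  prj2_incl1 : forall X Y, compose (prj2 X Y) (incl1 X Y) = 0;
  dsum_id : forall X Y,
    compose (incl1 X Y) (prj1 X Y) + compose (incl2 X Y) (prj2 X Y) =
    idm (dsum X Y)
}.

Arguments arr {a} _ _.
Arguments idm {a} X.
Arguments compose {a X Y Z} _ _.
Arguments zob {a}.
Arguments dsum {a} _ _.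
Arguments incl1 {a} X Y.
Arguments incl2 {a} X Y.
Arguments prj1 {a} X Y.
Arguments prj2 {a} X Y.

Declare Scope cat_scope.
Delimit Scope cat_scope with cat.
Notation "g ∘ f" := (compose g f) (at level 40, left associativity) : cat_scope.
Notation "X ⊕ Y" := (dsum X Y) (at level 50, left associativity) : cat_scope.
Local Open Scope cat_scope.

Definition is_iso (T : additiveCategory) (X Y : T) (h : arr X Y) : Prop :=
  exists k : arr Y X, k ∘ h = idm X /\ h ∘ k = idm Y.

(* (f, g) as a map into, respectively out of, a direct sum. *)
Definition colm (T : additiveCategory) (W X Y : T) (f : arr W X) (g : arr W Y) :
  arr W (X ⊕ Y) := incl1 X Y ∘ f + incl2 X Y ∘ g.
Definition rowm (T : additiveCategory) (W X Y : T) (f : arr X W) (g : arr Y W) :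
  arr (X ⊕ Y) W := f ∘ prj1 X Y + g ∘ prj2 X Y.
Definition dsumm (T : additiveCategory) (X X' Y Y' : T)
  (f : arr X Y) (f' : arr X' Y') : arr (X ⊕ X') (Y ⊕ Y') :=
  colm (f ∘ prj1 X X') (f' ∘ prj2 X X').

(* The suspension is an additive self-equivalence; it need not be an
   automorphism, nor preserve the chosen zero object or direct sums strictly. *)
Record suspendedCategory := SuspendedCategory {
  scat :> additiveCategory;
  susp : scat -> scat;
  suspm : forall X Y, arr X Y -> arr (susp X) (susp Y);
  suspm1 : forall X, suspm (idm X) = idm (susp X);
  suspmM : forall X Y Z (g : arr Y Z) (f : arr X Y),
    suspm (g ∘ f) = suspm g ∘ suspm f;
  suspmD : forall X Y (f g : arr X Y), suspm (f + g) = suspm f + suspm g;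
  suspm_bij : forall X Y, bijective (@suspm X Y);
  susp_esurj : forall Y, exists X (h : arr (susp X) Y), is_iso h
}.

Arguments susp {s} _.
Arguments suspm {s X Y} _.

(* The sum of q and q' with X + X' taken before suspending. *)
Definition dsumS (T : suspendedCategory) (C C' X X' : T)
  (q : arr C (susp X)) (q' : arr C' (susp X')) :
  arr (C ⊕ C') (susp (X ⊕ X')) :=
  rowm (suspm (incl1 X X') ∘ q) (suspm (incl2 X X') ∘ q').

(* Raw data: the vanishing of composites is the predicate [is_triangle]. *)
Record triangle (T : suspendedCategory) := Triangle {
  tX : T; tY : T; tC : T;
  tf : arr tX tY;
  ti : arr tY tC;
  tq : arr tC (susp tX)
}.

Arguments Triangle {T tX tY tC} tf ti tq.

Section Triangles.

Variable T : suspendedCategory.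

Definition is_triangle (D : triangle T) : Prop :=
  [/\ ti D ∘ tf D = 0, tq D ∘ ti D = 0 & suspm (tf D) ∘ tq D = 0].

Definition tri_mor (D D' : triangle T)
  (a : arr (tX D) (tX D')) (b : arr (tY D) (tY D')) (c : arr (tC D) (tC D')) :
  Prop :=
  [/\ b ∘ tf D = tf D' ∘ a, c ∘ ti D = ti D' ∘ b
    & suspm a ∘ tq D = tq D' ∘ c].

Definition tri_iso (D D' : triangle T) : Prop :=
  exists a b c, [/\ @tri_mor D D' a b c, is_iso a, is_iso b & is_iso c].

Definition tri_sum (D D' : triangle T) : triangle T :=
  Triangle (dsumm (tf D) (tf D')) (dsumm (ti D) (ti D')) (dsumS (tq D) (tq D')).

Definition tri_id1 (X : T) : triangle T :=
  Triangle (idm X) (0 : arr X zob) (0 : arr zob (susp X)).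
Definition tri_id2 (X : T) : triangle T :=
  Triangle (0 : arr zob X) (idm X) (0 : arr X (susp zob)).
Definition tri_id3 (X : T) : triangle T :=
  Triangle (0 : arr X zob) (0 : arr zob (susp X)) (idm (susp X)).

Definition contractible (A B C : T) : triangle T :=
  tri_sum (tri_sum (tri_id1 A) (tri_id2 B)) (tri_id3 C).

Definition tri_split1 (X Y : T) : triangle T :=
  Triangle (incl1 X Y) (prj2 X Y) (0 : arr Y (susp X)).
Definition tri_split2 (X Y : T) : triangle T :=
  Triangle (incl2 X Y) (prj1 X Y) (0 : arr X (susp Y)).

End Triangles.

(* Raw data on the base X -f-> Y -g-> Z: the conditions are [is_octahedral]. *)
Record octa (T : suspendedCategory) (X Y Z : T) (f : arr X Y) (g : arr Y Z) :=
  Octa {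
  oCf : T; oCg : T; oCgf : T;
  o_if : arr Y oCf;   o_qf : arr oCf (susp X);
  o_ig : arr Z oCg;   o_qg : arr oCg (susp Y);
  o_igf : arr Z oCgf; o_qgf : arr oCgf (susp X);
  o_gbar : arr oCf oCgf;
  o_fbar : arr oCgf oCg
}.

Arguments Octa {T X Y Z f g oCf oCg oCgf} _ _ _ _ _ _ _ _.

Section Octahedra.

Variable T : suspendedCategory.

Section OneOctahedron.

Variables (X Y Z : T) (f : arr X Y) (g : arr Y Z) (O : octa f g).

Definition oct_f : triangle T := Triangle f (o_if O) (o_qf O).
Definition oct_g : triangle T := Triangle g (o_ig O) (o_qg O).
Definition oct_gf : triangle T := Triangle (g ∘ f) (o_igf O) (o_qgf O).
Definition oct_t : triangle T :=
  Triangle (o_gbar O) (o_fbar O) (suspm (o_if O) ∘ o_qg O).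

Definition oct_comm : Prop :=
  [/\ o_gbar O ∘ o_if O = o_igf O ∘ g,
      o_qgf O ∘ o_gbar O = o_qf O,
      o_fbar O ∘ o_igf O = o_ig O
    & o_qg O ∘ o_fbar O = suspm f ∘ o_qgf O].

Definition oct_faces (P : triangle T -> Prop) : Prop :=
  [/\ P oct_f, P oct_g, P oct_gf & P oct_t].

Definition is_octahedral : Prop := oct_faces (@is_triangle T) /\ oct_comm.

Definition oct_sq1 : triangle T :=
  Triangle (colm g (- o_if O)) (rowm (o_igf O) (o_gbar O)) (o_qg O ∘ o_fbar O).
Definition oct_sq2 : triangle T :=
  Triangle (colm (o_qgf O) (- o_fbar O)) (rowm (suspm f) (o_qg O))
    (suspm (o_gbar O ∘ o_if O)).

End OneOctahedron.

Definition oct_mor (X Y Z X' Y' Z' : T) (f : arr X Y) (g : arr Y Z)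
    (f' : arr X' Y') (g' : arr Y' Z') (O : octa f g) (O' : octa f' g')
    (a : arr X X') (b : arr Y Y') (c : arr Z Z')
    (u : arr (oCf O) (oCf O')) (v : arr (oCg O) (oCg O'))
    (w : arr (oCgf O) (oCgf O')) : Prop :=
  [/\ @tri_mor T (oct_f O) (oct_f O') a b u,
      @tri_mor T (oct_g O) (oct_g O') b c v,
      @tri_mor T (oct_gf O) (oct_gf O') a c w
    & @tri_mor T (oct_t O) (oct_t O') u w v].

Definition oct_iso (X Y Z X' Y' Z' : T) (f : arr X Y) (g : arr Y Z)
    (f' : arr X' Y') (g' : arr Y' Z') (O : octa f g) (O' : octa f' g') : Prop :=
  exists a b c u v w,
    oct_mor (O := O) (O' := O') a b c u v w /\
    [/\ is_iso a, is_iso b & is_iso c] /\ [/\ is_iso u, is_iso v & is_iso w].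

Definition oct_sum (X Y Z X' Y' Z' : T) (f : arr X Y) (g : arr Y Z)
    (f' : arr X' Y') (g' : arr Y' Z') (O : octa f g) (O' : octa f' g') :
    octa (dsumm f f') (dsumm g g') :=
  Octa (dsumm (o_if O) (o_if O')) (dsumS (o_qf O) (o_qf O'))
    (dsumm (o_ig O) (o_ig O')) (dsumS (o_qg O) (o_qg O'))
    (dsumm (o_igf O) (o_igf O')) (dsumS (o_qgf O) (o_qgf O'))
    (dsumm (o_gbar O) (o_gbar O')) (dsumm (o_fbar O) (o_fbar O')).

(* The degenerate octahedra of a triangle X -f-> Y -> C -> susp X, on the bases
   0 -> X -f-> Y, X = X -f-> Y and X -f-> Y = Y. *)
Definition oct_deg0 (D : triangle T) : octa (0 : arr zob (tX D)) (tf D) :=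
  Octa (idm (tX D)) 0 (ti D) (tq D) (idm (tY D)) 0 (tf D) (ti D).
Definition oct_deg1 (D : triangle T) : octa (idm (tX D)) (tf D) :=
  Octa (0 : arr (tX D) zob) 0 (ti D) (tq D) (ti D) (tq D) 0 (idm (tC D)).
Definition oct_deg2 (D : triangle T) : octa (tf D) (idm (tY D)) :=
  Octa (ti D) (tq D) (0 : arr (tY D) zob) 0 (ti D) (tq D) (idm (tC D)) 0.

End Octahedra.

Record triangulatedCategory := TriangulatedCategory {
  tcat :> suspendedCategory;
  distinguished : triangle tcat -> Prop;
  dist_iso : forall D D', tri_iso D D' -> distinguished D -> distinguished D';
  dist_id1 : forall X, distinguished (tri_id1 X);
  dist_ex : forall (X Y : tcat) (f : arr X Y),
    exists C (i : arr Y C) (q : arr C (susp X)), distinguished (Triangle f i q);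
  dist_rot : forall (X Y C : tcat) (f : arr X Y) (i : arr Y C) (q : arr C (susp X)),
    distinguished (Triangle f i q) <-> distinguished (Triangle i q (- suspm f));
  dist_mor : forall D D' (a : arr (tX D) (tX D')) (b : arr (tY D) (tY D')),
    distinguished D -> distinguished D' -> b ∘ tf D = tf D' ∘ a ->
    exists c, @tri_mor tcat D D' a b c;
  dist_oct : forall (X Y Z Cf Cg Cgf : tcat) (f : arr X Y) (g : arr Y Z)
    (i_f : arr Y Cf) (q_f : arr Cf (susp X))
    (i_g : arr Z Cg) (q_g : arr Cg (susp Y))
    (i_gf : arr Z Cgf) (q_gf : arr Cgf (susp X)),
    distinguished (Triangle f i_f q_f) -> distinguished (Triangle g i_g q_g) ->
    distinguished (Triangle (g ∘ f) i_gf q_gf) ->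
    exists gbar fbar,
      let O : octa f g := Octa i_f q_f i_g q_g i_gf q_gf gbar fbar in
      oct_comm O /\ distinguished (oct_t O)
}.

Arguments distinguished {t} _.

Section SharpNotions.

Variable T : triangulatedCategory.

Definition virtual_triangle (D : triangle T) : Prop :=
  is_triangle D /\
  exists (A B C : T) (X Y Z : T)
         (f f' : arr X Y) (i i' : arr Y Z) (q q' : arr Z (susp X)),
    tri_iso (tri_sum D (contractible A B C)) (Triangle f i q) /\
    [/\ distinguished (Triangle f' i q), distinguished (Triangle f i' q)
      & distinguished (Triangle f i q')].

Section OneOctahedron.

Variables (X Y Z : T) (f : arr X Y) (g : arr Y Z) (O : octa f g).

Definition ordinary_octahedron : Prop :=
  is_octahedral O /\ oct_faces O distinguished.
Definition special_octahedron : Prop :=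
  [/\ ordinary_octahedron, distinguished (oct_sq1 O)
    & distinguished (oct_sq2 O)].
Definition virtual_octahedron : Prop :=
  is_octahedral O /\ oct_faces O virtual_triangle.

End OneOctahedron.

(* The properties of the distinguished 3-triangles of a strongly triangulated
   category (whose distinguished 2-triangles are the distinguished triangles);
   the higher n-triangles play no role in K_1. The empty direct sum is
   distinguished, as a degenerate octahedron. *)
Record strongTriangulation := StrongTriangulation {
  sdist : forall (X Y Z : T) (f : arr X Y) (g : arr Y Z), octa f g -> Prop;
  sdist_ordinary : forall (X Y Z : T) (f : arr X Y) (g : arr Y Z) (O : octa f g),
    sdist O -> ordinary_octahedron O;
  sdist_iso : forall (X Y Z X' Y' Z' : T) (f : arr X Y) (g : arr Y Z)
    (f' : arr X' Y') (g' : arr Y' Z') (O : octa f g) (O' : octa f' g'),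
    oct_iso O O' -> sdist O -> sdist O';
  sdist_sum : forall (X Y Z X' Y' Z' : T) (f : arr X Y) (g : arr Y Z)
    (f' : arr X' Y') (g' : arr Y' Z') (O : octa f g) (O' : octa f' g'),
    sdist O -> sdist O' -> sdist (oct_sum O O');
  sdist_deg0 : forall D : triangle T, distinguished D -> sdist (oct_deg0 D);
  sdist_deg1 : forall D : triangle T, distinguished D -> sdist (oct_deg1 D);
  sdist_deg2 : forall D : triangle T, distinguished D -> sdist (oct_deg2 D);
  sdist_ex : forall (X Y Z : T) (f : arr X Y) (g : arr Y Z),
    exists O : octa f g, sdist O;
  sdist_mor : forall (X Y Z X' Y' Z' : T) (f : arr X Y) (g : arr Y Z)
    (f' : arr X' Y') (g' : arr Y' Z') (O : octa f g) (O' : octa f' g')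
    (a : arr X X') (b : arr Y Y') (c : arr Z Z'),
    sdist O -> sdist O' -> b ∘ f = f' ∘ a -> c ∘ g = g' ∘ b ->
    exists u v w, oct_mor (O := O) (O' := O') a b c u v w
}.

(* The decoration s is available only when T carries a strong triangulation. *)
Inductive sharp : Type :=
| sharp_b
| sharp_d
| sharp_v
| sharp_s of strongTriangulation.

Definition sharp_triangle (s : sharp) (D : triangle T) : Prop :=
  match s with
  | sharp_b | sharp_d | sharp_s _ => distinguished D
  | sharp_v => virtual_triangle D
  end.

Definition sharp_octahedron (s : sharp) (X Y Z : T) (f : arr X Y) (g : arr Y Z)
    (O : octa f g) : Prop :=
  match s with
  | sharp_b => ordinary_octahedron O
  | sharp_d => special_octahedron O
  | sharp_v => virtual_octahedron O
  | sharp_s st => sdist st O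
  end.

Inductive Dgen1 (s : sharp) : Type :=
| DIso (X X' : T) (h : arr X X') of is_iso h
| DTri (D : triangle T) of sharp_triangle s D.

Local Notation word0T s := (word0 T (Dgen1 s)).
Local Notation word1T s := (word1 T (Dgen1 s)).

Definition gOb s (X : T) : word0T s := Gen0 X.
Definition gIso s (X X' : T) (h : arr X X') (Hh : is_iso h) : word1T s :=
  Gen1 (DIso s Hh).
Definition gTri s (D : triangle T) (HD : sharp_triangle s D) : word1T s :=
  Gen1 (DTri HD).

Inductive Drel0 (s : sharp) : word0T s -> word0T s -> Prop :=
| Drel_bd_iso (X X' : T) (h : arr X X') (Hh : is_iso h) :
    Drel0 (Bd (gIso s Hh)) (- gOb s X' + gOb s X)
| Drel_bd_tri (D : triangle T) (HD : sharp_triangle s D) :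
    Drel0 (Bd (gTri HD)) (- gOb s (tY D) + gOb s (tC D) + gOb s (tX D))
| Drel_zob : Drel0 (gOb s zob) 0.

(* The generators carry proofs, over which the relations quantify; classes in
   the presented module do not depend on them. *)
Inductive Drel1 (s : sharp) : word1T s -> word1T s -> Prop :=
| Drel_idm (X : T) (H : is_iso (idm X)) : Drel1 (gIso s H) 0
| Drel_id1 (X : T) (H : sharp_triangle s (tri_id1 X)) : Drel1 (gTri H) 0
| Drel_id2 (X : T) (H : sharp_triangle s (tri_id2 X)) : Drel1 (gTri H) 0
| Drel_comp (X Y Z : T) (k : arr Y Z) (h : arr X Y)
    (Hk : is_iso k) (Hh : is_iso h) (Hkh : is_iso (k ∘ h)) :
    Drel1 (gIso s Hkh) (gIso s Hk + gIso s Hh)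
| Drel_tri_iso (D D' : triangle T)
    (HD : sharp_triangle s D) (HD' : sharp_triangle s D')
    (a : arr (tX D) (tX D')) (b : arr (tY D) (tY D')) (c : arr (tC D) (tC D'))
    (Ha : is_iso a) (Hb : is_iso b) (Hc : is_iso c) :
    @tri_mor T D D' a b c ->
    Drel1 (gIso s Ha + actw (gIso s Hc) (gOb s (tX D)))
          (- gTri HD' + gIso s Hb + gTri HD)
| Drel_oct (X Y Z : T) (f : arr X Y) (g : arr Y Z) (O : octa f g)
    (Hf : sharp_triangle s (oct_f O)) (Hg : sharp_triangle s (oct_g O))
    (Hgf : sharp_triangle s (oct_gf O)) (Ht : sharp_triangle s (oct_t O)) :
    sharp_octahedron s O ->
    Drel1 (gTri Hg + gTri Hf) (gTri Hgf + actw (gTri Ht) (gOb s X))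
| Drel_br (X Y : T) (H1 : sharp_triangle s (tri_split1 X Y))
    (H2 : sharp_triangle s (tri_split2 X Y)) :
    Drel1 (Br (gOb s X) (gOb s Y)) (- gTri H2 + gTri H1).

Definition Dpres (s : sharp) : sqmPresentation :=
  SqmPresentation (@Drel0 s) (@Drel1 s).

Definition Dstar (s : sharp) : stableQuadraticModule := presentedSqm (Dpres s).

Definition K1 (s : sharp) := pi1 (Dstar s).

Definition tri_class (s : sharp) (D : triangle T) (HD : sharp_triangle s D) :
  sqm1 (Dstar s) := @cls1 (Dpres s) (gTri HD).

End SharpNotions.

(* Main.v *)
From HB Require Import structures.
From mathcomp Require Import all_boot all_order generic_quotient all_algebra.
From mathcomp Require Import ring.
From mathcomp.classical Require Import boolp.
Require Import Defs.

Set Implicit Arguments.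
Unset Strict Implicit.
Unset Printing Implicit Defensive.

Import Order.TTheory GRing.Theory Num.Theory.
Local Open Scope ring_scope.
Local Open Scope cat_scope.

(** Modulo brackets the degree 1 part of the module is an abelian group, because
    its commutators are brackets. Sums of degenerate octahedra are octahedra of
    every kind considered, and they show that in this quotient the class of a
    direct sum of triangles is the sum of the classes, up to the classes of
    split triangles on pairs of corresponding objects ([tab_sum]). Consequently
    an arbitrary product of generators and inverses of generators can be
    collected into two triangles, [X -> P -> C] with a negative sign and
    [X -> N -> C] with a positive one, where [P] and [N] are direct sums of lists
    of objects, up to the corrections comparing [P] and [N] with the formal sums
    of these lists ([all_presentable]). If the element has trivial boundary,
    both lists contain every nonzero object equally often, since degree 0 is
    free enough for multiplicities to be well defined ([nil2_detect]). Then [P]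
    and [N] are isomorphic by a permutation of summands whose class is the
    difference of the corrections ([leqv_multiset]), and after transport the two
    triangles have the same objects.

    So an element [x] of the kernel is a difference of two such triangles times a
    product of brackets of objects whose boundary vanishes. Mapping degree 0 to
    the Heisenberg group shows that the brackets of distinct objects in this
    product cancel in pairs ([obbr_ker]). There remain brackets of an object [A]
    with itself, which are differences of the two split triangles on
    [A -> A + A -> A] by the last defining relation.

    It remains to multiply such differences. They are central and fixed by the
    action, so the same octahedra, now used without passing to the quotient,
    show that the difference of two direct sums is the product of the
    differences: the correction terms only depend on the objects ([dif_sum]). *)

(** * Additive and suspended categories *)

Section AdditiveCategories.

Variable T : additiveCategory.
Implicit Types W X Y Z : T.

Lemma comp0m W X Y (f : arr W X) : (0 : arr X Y) ∘ f = 0.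
Proof. by apply: (addrI (0 ∘ f)); rewrite -compDl !addr0. Qed.

Lemma compm0 W X Y (g : arr X Y) : g ∘ (0 : arr W X) = 0.
Proof. by apply: (addrI (g ∘ 0)); rewrite -compDr !addr0. Qed.

Lemma compNm W X Y (g : arr X Y) (f : arr W X) : (- g) ∘ f = - (g ∘ f).
Proof. by apply: (addrI (g ∘ f)); rewrite -compDl !subrr comp0m. Qed.

Lemma compmN W X Y (g : arr X Y) (f : arr W X) : g ∘ (- f) = - (g ∘ f).
Proof. by apply: (addrI (g ∘ f)); rewrite -compDr !subrr compm0. Qed.

Lemma prj1_incl1A W X Y (h : arr X W) : h ∘ prj1 X Y ∘ incl1 X Y = h.
Proof. by rewrite -compA prj1_incl1 compm1. Qed.
Lemma prj2_incl2A W X Y (h : arr Y W) : h ∘ prj2 X Y ∘ incl2 X Y = h.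
Proof. by rewrite -compA prj2_incl2 compm1. Qed.
Lemma prj1_incl2A W X Y (h : arr X W) : h ∘ prj1 X Y ∘ incl2 X Y = 0.
Proof. by rewrite -compA prj1_incl2 compm0. Qed.
Lemma prj2_incl1A W X Y (h : arr Y W) : h ∘ prj2 X Y ∘ incl1 X Y = 0.
Proof. by rewrite -compA prj2_incl1 compm0. Qed.

(** Biproduct rewriting: distributes composition and contracts every
    projection that meets an inclusion. *)
Definition catE :=
  (compA, compDl, compDr, comp1m, compm1, comp0m, compm0, compNm, compmN,
   prj1_incl1, prj2_incl2, prj1_incl2, prj2_incl1,
   prj1_incl1A, prj2_incl2A, prj1_incl2A, prj2_incl1A,
   ((fun X Y => @addr0 (arr X Y)), (fun X Y => @add0r (arr X Y)),
    (fun X Y => @oppr0 (arr X Y)), (fun X Y => @opprK (arr X Y)))).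

Lemma eq_dsum X Y W (f g : arr (X ⊕ Y) W) :
  f ∘ incl1 X Y = g ∘ incl1 X Y -> f ∘ incl2 X Y = g ∘ incl2 X Y -> f = g.
Proof.
by move=> e1 e2; rewrite -[f]compm1 -[g]compm1 -dsum_id !compDr !compA e1 e2.
Qed.

Lemma eq_to_dsum X Y W (f g : arr W (X ⊕ Y)) :
  prj1 X Y ∘ f = prj1 X Y ∘ g -> prj2 X Y ∘ f = prj2 X Y ∘ g -> f = g.
Proof.
by move=> e1 e2; rewrite -[f]comp1m -[g]comp1m -dsum_id !compDl -!compA e1 e2.
Qed.

Lemma idm_iso X : is_iso (idm X).
Proof. by exists (idm X); rewrite comp1m. Qed.

Lemma comp_iso X Y Z (g : arr Y Z) (f : arr X Y) :
  is_iso g -> is_iso f -> is_iso (g ∘ f).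
Proof.
move=> [g' [g'g gg']] [f' [f'f ff']]; exists (f' ∘ g'); split.
  by rewrite compA -(compA f') g'g compm1.
by rewrite compA -(compA g) ff' compm1.
Qed.

Lemma opp_iso X Y (f : arr X Y) : is_iso f -> is_iso (- f).
Proof. by move=> [f' [f'f ff']]; exists (- f'); rewrite !catE. Qed.

Lemma dsumm_iso X X' Y Y' (f : arr X Y) (f' : arr X' Y') :
  is_iso f -> is_iso f' -> is_iso (dsumm f f').
Proof.
move=> [g [gf fg]] [g' [gf' fg']]; exists (dsumm g g').
by rewrite /dsumm /colm !catE -!(compA (incl1 _ _)) -!(compA (incl2 _ _))
  gf gf' fg fg' !catE !dsum_id.
Qed.

Definition is_zero X := idm X = 0.

Lemma zob_is_zero : is_zero (@zob T). Proof. exact: idm_zob. Qed.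

Lemma to_zero X Y (f : arr X Y) : is_zero Y -> f = 0.
Proof. by move=> Y0; rewrite -[f]comp1m Y0 comp0m. Qed.

Lemma from_zero X Y (f : arr X Y) : is_zero X -> f = 0.
Proof. by move=> X0; rewrite -[f]compm1 X0 compm0. Qed.

Lemma dsum_is_zero X Y : is_zero X -> is_zero Y -> is_zero (X ⊕ Y).
Proof.
rewrite /is_zero => X0 Y0; rewrite -dsum_id.
by rewrite -[incl1 _ _]compm1 X0 -[incl2 _ _]compm1 Y0 !catE.
Qed.

Lemma zero_iso X Y : is_zero X -> is_zero Y -> is_iso (0 : arr X Y).
Proof. by move=> X0 Y0; exists 0; rewrite !catE X0 Y0. Qed.

Lemma incl1_zero_iso X Y : is_zero Y -> is_iso (incl1 X Y).
Proof.
move=> Y0; exists (prj1 X Y); rewrite -dsum_id prj1_incl1; split=> //.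
by rewrite (to_zero (prj2 X Y) Y0) !catE.
Qed.

Lemma incl2_zero_iso X Y : is_zero X -> is_iso (incl2 X Y).
Proof.
move=> X0; exists (prj2 X Y); rewrite -dsum_id prj2_incl2; split=> //.
by rewrite (to_zero (prj1 X Y) X0) !catE.
Qed.

Lemma prj1_zero_iso X Y : is_zero Y -> is_iso (prj1 X Y).
Proof.
move=> Y0; exists (incl1 X Y); rewrite -dsum_id prj1_incl1; split=> //.
by rewrite (to_zero (prj2 X Y) Y0) !catE.
Qed.

Lemma prj2_zero_iso X Y : is_zero X -> is_iso (prj2 X Y).
Proof.
move=> X0; exists (incl2 X Y); rewrite -dsum_id prj2_incl2; split=> //.
by rewrite (to_zero (prj1 X Y) X0) !catE.
Qed.

(** The middle-four interchange. *)
Definition midm W X Y Z : arr ((W ⊕ X) ⊕ (Y ⊕ Z)) ((W ⊕ Y) ⊕ (X ⊕ Z)) :=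
  rowm (dsumm (incl1 W Y) (incl1 X Z)) (dsumm (incl2 W Y) (incl2 X Z)).

Lemma midmK W X Y Z : midm W Y X Z ∘ midm W X Y Z = idm _.
Proof.
apply: eq_dsum; apply: eq_dsum; rewrite /midm /rowm /dsumm /colm !catE;
by rewrite ?catE.
Qed.

Lemma midm_iso W X Y Z : is_iso (midm W X Y Z).
Proof. by exists (midm W Y X Z); rewrite !midmK. Qed.

Lemma dsumm_comp X X' Y Y' Z Z' (g : arr Y Z) (g' : arr Y' Z')
    (f : arr X Y) (f' : arr X' Y') :
  dsumm g g' ∘ dsumm f f' = dsumm (g ∘ f) (g' ∘ f').
Proof. by rewrite /dsumm /colm !catE. Qed.

End AdditiveCategories.

Section SuspendedCategories.

Variable T : suspendedCategory.
Implicit Types W X Y Z : T.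

Lemma suspm0 X Y : suspm (0 : arr X Y) = 0.
Proof. by apply: (addrI (suspm 0)); rewrite -suspmD !addr0. Qed.

Lemma suspmN X Y (f : arr X Y) : suspm (- f) = - suspm f.
Proof. by apply: (addrI (suspm f)); rewrite -suspmD !subrr suspm0. Qed.

Lemma Sprj1_incl1 X Y : suspm (prj1 X Y) ∘ suspm (incl1 X Y) = idm _.
Proof. by rewrite -suspmM prj1_incl1 suspm1. Qed.
Lemma Sprj2_incl2 X Y : suspm (prj2 X Y) ∘ suspm (incl2 X Y) = idm _.
Proof. by rewrite -suspmM prj2_incl2 suspm1. Qed.
Lemma Sprj1_incl2 X Y : suspm (prj1 X Y) ∘ suspm (incl2 X Y) = 0.
Proof. by rewrite -suspmM prj1_incl2 suspm0. Qed.
Lemma Sprj2_incl1 X Y : suspm (prj2 X Y) ∘ suspm (incl1 X Y) = 0.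
Proof. by rewrite -suspmM prj2_incl1 suspm0. Qed.

Lemma Sprj1_incl1A W X Y (h : arr (susp X) W) :
  h ∘ suspm (prj1 X Y) ∘ suspm (incl1 X Y) = h.
Proof. by rewrite -compA Sprj1_incl1 compm1. Qed.
Lemma Sprj2_incl2A W X Y (h : arr (susp Y) W) :
  h ∘ suspm (prj2 X Y) ∘ suspm (incl2 X Y) = h.
Proof. by rewrite -compA Sprj2_incl2 compm1. Qed.
Lemma Sprj1_incl2A W X Y (h : arr (susp X) W) :
  h ∘ suspm (prj1 X Y) ∘ suspm (incl2 X Y) = 0.
Proof. by rewrite -compA Sprj1_incl2 compm0. Qed.
Lemma Sprj2_incl1A W X Y (h : arr (susp Y) W) :
  h ∘ suspm (prj2 X Y) ∘ suspm (incl1 X Y) = 0.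
Proof. by rewrite -compA Sprj2_incl1 compm0. Qed.

Definition suspE :=
  (suspmM, suspmD, suspm0, suspmN, suspm1, Sprj1_incl1, Sprj2_incl2,
   Sprj1_incl2, Sprj2_incl1, Sprj1_incl1A, Sprj2_incl2A, Sprj1_incl2A,
   Sprj2_incl1A, catE T).

Lemma Sdsum_id X Y :
  suspm (incl1 X Y) ∘ suspm (prj1 X Y) + suspm (incl2 X Y) ∘ suspm (prj2 X Y)
  = idm (susp (X ⊕ Y)).
Proof. by rewrite -!suspmM -suspmD dsum_id suspm1. Qed.

Lemma eq_to_Sdsum X Y W (f g : arr W (susp (X ⊕ Y))) :
  suspm (prj1 X Y) ∘ f = suspm (prj1 X Y) ∘ g ->
  suspm (prj2 X Y) ∘ f = suspm (prj2 X Y) ∘ g -> f = g.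
Proof.
by move=> e1 e2; rewrite -[f]comp1m -[g]comp1m -Sdsum_id !compDl -!compA e1 e2.
Qed.

Lemma susp_is_zero X : is_zero X -> is_zero (susp X).
Proof. by rewrite /is_zero -suspm1 => ->; rewrite suspm0. Qed.

Lemma suspmI X Y (f g : arr X Y) : suspm f = suspm g -> f = g.
Proof. exact: bij_inj (@suspm_bij T X Y) _ _. Qed.

(** The comparison showing that suspension preserves direct sums up to
    isomorphism, which [dsumS] builds in. *)
Definition dsum_susp X Y : arr (susp X ⊕ susp Y) (susp (X ⊕ Y)) :=
  rowm (suspm (incl1 X Y)) (suspm (incl2 X Y)).

Lemma dsum_susp_iso X Y : is_iso (dsum_susp X Y).
Proof.
exists (colm (suspm (prj1 X Y)) (suspm (prj2 X Y))).
rewrite /dsum_susp /rowm /colm; split; first by rewrite !suspE dsum_id.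
by rewrite !suspE Sdsum_id.
Qed.

Lemma susp_dsummS X X' C C' Y Y' (f : arr X Y) (f' : arr X' Y')
    (q : arr C (susp X)) (q' : arr C' (susp X')) :
  suspm (dsumm f f') ∘ dsumS q q' = dsumS (suspm f ∘ q) (suspm f' ∘ q').
Proof. by rewrite /dsumS /rowm /dsumm /colm !suspE. Qed.

Lemma dsumS_dsumm X X' C C' Y Y' (f : arr Y C) (f' : arr Y' C')
    (q : arr C (susp X)) (q' : arr C' (susp X')) :
  dsumS q q' ∘ dsumm f f' = dsumS (q ∘ f) (q' ∘ f').
Proof. by rewrite /dsumS /rowm /dsumm /colm !suspE. Qed.

(** ** Morphisms and direct sums of triangles *)

Lemma tri_iso_refl (D : triangle T) : tri_iso D D.
Proof.
exists (idm _), (idm _), (idm _).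
by split; [split; rewrite ?suspE | exact: idm_iso ..].
Qed.

Lemma tri_iso_trans (D D' D'' : triangle T) :
  tri_iso D D' -> tri_iso D' D'' -> tri_iso D D''.
Proof.
move=> [a [b [c [[m1 m2 m3] ia ib ic]]]] [a' [b' [c' [[n1 n2 n3] ia' ib' ic']]]].
exists (a' ∘ a), (b' ∘ b), (c' ∘ c).
split; [split | exact: comp_iso | exact: comp_iso | exact: comp_iso].
- by rewrite -compA m1 compA n1 compA.
- by rewrite -compA m2 compA n2 compA.
- by rewrite suspmM -compA m3 compA n3 compA.
Qed.

Lemma tri_iso_sym (D D' : triangle T) : tri_iso D D' -> tri_iso D' D.
Proof.
move=> [a [b [c [[m1 m2 m3] [a' [a'a aa']] [b' [b'b bb']] [c' [c'c cc']]]]]].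
exists a', b', c'; split; [split| by exists a | by exists b | by exists c].
- by rewrite -[LHS]compm1 -aa' -!compA (compA (tf D')) -m1 !compA b'b comp1m.
- by rewrite -[LHS]compm1 -bb' -!compA (compA (ti D')) -m2 !compA c'c comp1m.
- rewrite -[LHS]compm1 -cc' -!compA (compA (tq D')) -m3 !compA -suspmM a'a.
  by rewrite suspm1 comp1m.
Qed.

Lemma tri_sum_iso (D1 D1' D2 D2' : triangle T) :
  tri_iso D1 D1' -> tri_iso D2 D2' -> tri_iso (tri_sum D1 D2) (tri_sum D1' D2').
Proof.
move=> [a [b [c [[m1 m2 m3] ia ib ic]]]] [a' [b' [c' [[n1 n2 n3] ia' ib' ic']]]].
exists (dsumm a a'), (dsumm b b'), (dsumm c c').
split; [split | exact: dsumm_iso | exact: dsumm_iso | exact: dsumm_iso] => /=.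
- by rewrite !dsumm_comp m1 n1.
- by rewrite !dsumm_comp m2 n2.
- by rewrite susp_dsummS dsumS_dsumm m3 n3.
Qed.

(** Interchange lets a sum of two stabilized triangles be regrouped as the
    stabilization of their sum. *)
Lemma tri_sum_mid (D1 D2 D3 D4 : triangle T) :
  tri_iso (tri_sum (tri_sum D1 D2) (tri_sum D3 D4))
          (tri_sum (tri_sum D1 D3) (tri_sum D2 D4)).
Proof.
exists (midm _ _ _ _), (midm _ _ _ _), (midm _ _ _ _).
split; [split | exact: midm_iso | exact: midm_iso | exact: midm_iso] => /=.
- by apply: eq_dsum; apply: eq_dsum; rewrite /midm /rowm /dsumm /colm !catE.
- by apply: eq_dsum; apply: eq_dsum; rewrite /midm /rowm /dsumm /colm !catE.
- by apply: eq_dsum; apply: eq_dsum;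
    rewrite /midm /dsumS /rowm /dsumm /colm !suspE.
Qed.

Lemma tri_id1_sum (A B : T) :
  tri_iso (tri_sum (tri_id1 A) (tri_id1 B)) (tri_id1 (A ⊕ B)).
Proof.
have z1 := zob_is_zero T; have z2 := dsum_is_zero z1 z1.
exists (idm _), (idm _), 0; split; [split| | |exact: zero_iso z2 z1] => /=.
- by rewrite /dsumm /colm !catE dsum_id.
- by rewrite !catE; apply: to_zero.
- by rewrite (from_zero (dsumS _ _) z2) !catE.
- exact: idm_iso.
- exact: idm_iso.
Qed.

Lemma tri_id2_sum (A B : T) :
  tri_iso (tri_sum (tri_id2 A) (tri_id2 B)) (tri_id2 (A ⊕ B)).
Proof.
have z1 := zob_is_zero T; have z2 := dsum_is_zero z1 z1.
exists 0, (idm _), (idm _); split; [split|exact: zero_iso z2 z1| | ] => /=.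
- by rewrite !catE; apply: from_zero.
- by rewrite /dsumm /colm !catE dsum_id.
- by rewrite !suspE.
- exact: idm_iso.
- exact: idm_iso.
Qed.

Lemma tri_id3_sum (A B : T) :
  tri_iso (tri_sum (tri_id3 A) (tri_id3 B)) (tri_id3 (A ⊕ B)).
Proof.
have z1 := zob_is_zero T; have z2 := dsum_is_zero z1 z1.
exists (idm _), 0, (dsum_susp A B); split; [split| |exact: zero_iso z2 z1| ] => /=.
- by rewrite !catE.
- by rewrite !catE; apply: from_zero.
- by rewrite /dsumS /dsum_susp /rowm !suspE.
- exact: idm_iso.
- exact: dsum_susp_iso.
Qed.

Lemma contractible_sum (A B C A' B' C' : T) :
  tri_iso (tri_sum (contractible A B C) (contractible A' B' C'))
          (contractible (A ⊕ A') (B ⊕ B') (C ⊕ C')).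
Proof.
apply: tri_iso_trans (tri_sum_mid _ _ _ _) _.
apply: tri_sum_iso (tri_id3_sum _ _).
apply: tri_iso_trans (tri_sum_mid _ _ _ _) _.
exact: tri_sum_iso (tri_id1_sum _ _) (tri_id2_sum _ _).
Qed.

Lemma sum_is_triangle (D D' : triangle T) :
  is_triangle D -> is_triangle D' -> is_triangle (tri_sum D D').
Proof.
move=> [a b c] [a' b' c']; split=> /=.
- by rewrite dsumm_comp a a' /dsumm /colm !catE.
- by rewrite dsumS_dsumm b b' /dsumS /rowm !catE.
- by rewrite susp_dsummS c c' /dsumS /rowm !catE.
Qed.

End SuspendedCategories.

(** * Distinguished triangles and octahedra *)

Section Distinguished.

Variable T : triangulatedCategory.
Implicit Types W X Y Z : T.
Implicit Types D : triangle T.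

Definition rot D : triangle T := Triangle (ti D) (tq D) (- suspm (tf D)).

Lemma dist_rotP D : distinguished D <-> distinguished (rot D).
Proof. by case: D => X Y C f i q; exact: dist_rot. Qed.

Lemma dist_if D : distinguished D -> ti D ∘ tf D = 0.
Proof.
move=> dD; have [c [_ h _]] := @dist_mor T (tri_id1 (tX D)) D (idm _) (tf D)
  (dist_id1 _) dD erefl.
by rewrite -h /= compm0.
Qed.

Lemma dist_is_triangle D : distinguished D -> is_triangle D.
Proof.
move=> dD; have dR := (dist_rotP _).1 dD; have dRR := (dist_rotP _).1 dR.
split; [exact: dist_if | exact: (dist_if dR) |].
by have /= := dist_if dRR; rewrite compNm => /eqP; rewrite oppr_eq0 => /eqP.
Qed.

(** Exactness of the sequences of morphisms out of every object [W]. Unlike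
    being distinguished, it visibly passes to direct sums. *)
Definition exact_at X Y Z (f : arr X Y) (g : arr Y Z) :=
  forall W (w : arr W Y), g ∘ w = 0 -> exists v, w = f ∘ v.

(** A map [w] out of [W] killed by [ti D] is part of a commutative square from
    the rotation of [W = W -> 0] to the rotation of [D]; the third component of
    a morphism of triangles completing it is the suspension of the lift. *)
Lemma dist_exact D : distinguished D -> exact_at (tf D) (ti D).
Proof.
move=> dD W w iw.
have dW : distinguished (rot (tri_id1 W)) by exact: (dist_rotP _).1 (@dist_id1 T W).
have sq : (0 : arr zob (tC D)) ∘ tf (rot (tri_id1 W)) = tf (rot D) ∘ w.
  by rewrite /= iw compm0.
have [c [_ _ hc]] := dist_mor dW ((dist_rotP _).1 dD) sq.
have [s _ sK] := @suspm_bij T W (tX D).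
exists (s c); apply: suspmI; rewrite suspmM sK.
by move: hc; rewrite /= suspm1 compmN compNm compm1 => /oppr_inj.
Qed.

Lemma exact_at_opp X Y Z (f : arr X Y) (g : arr Y Z) :
  exact_at f (- g) -> exact_at f g.
Proof. by move=> ex W w gw; apply: ex; rewrite compNm gw oppr0. Qed.

Lemma dist_exact3 D : distinguished D ->
  [/\ exact_at (tf D) (ti D), exact_at (ti D) (tq D)
    & exact_at (tq D) (suspm (tf D))].
Proof.
move=> dD; have dR := (dist_rotP _).1 dD; have dRR := (dist_rotP _).1 dR.
split; [exact: dist_exact | exact: (dist_exact dR) |].
exact/exact_at_opp/(dist_exact dRR).
Qed.

(** The second triangle enters the diagram chase only through the exactness of
    its sequences of morphisms, which is what is known of a direct sum. *)
Lemma five_lemma X Y C C' (f : arr X Y) (i : arr Y C) (q : arr C (susp X))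
    (i' : arr Y C') (q' : arr C' (susp X)) (c : arr C C') :
  distinguished (Triangle f i q) -> is_triangle (Triangle f i' q') ->
  exact_at f i' -> exact_at i' q' -> c ∘ i = i' -> q' ∘ c = q -> is_iso c.
Proof.
move=> dD [_ _ /= fq'] exY exC ci qc.
have [_ exC0 exX0] := dist_exact3 dD.
have [/= if0 qi0 _] := dist_is_triangle dD.
have c_inj W (w : arr W C) : c ∘ w = 0 -> w = 0.
  move=> cw; have [y Ey] : exists y, w = i ∘ y.
    by apply: exC0; rewrite /= -qc -compA cw compm0.
  have [x Ex] : exists x, y = f ∘ x by apply: exY; rewrite -ci -compA -Ey.
  by rewrite Ey Ex compA if0 comp0m.
have [k ck] : exists k, c ∘ k = idm C'.
  have [v Ev] : exists v, q' = q ∘ v by apply: exX0.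
  have [y Ey] : exists y, idm C' - c ∘ v = i' ∘ y.
    by apply: exC; rewrite compDr compmN compA qc compm1 -Ev subrr.
  exists (v + i ∘ y).
  by rewrite compDr (compA c i) ci -Ey addrC subrK.
exists k; split=> //; apply/eqP; rewrite -subr_eq0; apply/eqP/c_inj.
by rewrite compDr compmN compA ck comp1m compm1 subrr.
Qed.

Lemma exact_dsumm X X' Y Y' Z Z' (f : arr X Y) (f' : arr X' Y') (g : arr Y Z)
    (g' : arr Y' Z') :
  exact_at f g -> exact_at f' g' -> exact_at (dsumm f f') (dsumm g g').
Proof.
move=> ex ex' W w; rewrite /dsumm /colm !catE => gw.
have [v Ev] : exists v, prj1 Y Y' ∘ w = f ∘ v.
  by apply: ex; rewrite -[RHS](compm0 W (prj1 Z Z')) -gw !catE.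
have [v' Ev'] : exists v, prj2 Y Y' ∘ w = f' ∘ v.
  by apply: ex'; rewrite -[RHS](compm0 W (prj2 Z Z')) -gw !catE.
exists (colm v v'); rewrite /colm.
by apply: eq_to_dsum; rewrite !catE.
Qed.

Lemma exact_dsumS X X' C C' Y Y' (f : arr Y C) (f' : arr Y' C')
    (q : arr C (susp X)) (q' : arr C' (susp X')) :
  exact_at f q -> exact_at f' q' -> exact_at (dsumm f f') (dsumS q q').
Proof.
move=> ex ex' W w qw; apply: (exact_dsumm ex ex').
have [k [kK _]] := dsum_susp_iso X X'.
rewrite -[dsumm q q' ∘ w]comp1m -kK -!compA.
suff -> : dsum_susp X X' ∘ (dsumm q q' ∘ w) = 0 by rewrite compm0.
by rewrite -qw /dsumS /dsum_susp /dsumm /colm /rowm !catE.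
Qed.

(** A distinguished triangle on the arrow [dsumm (tf D) (tf D')] projects to both
    summands; the combined map to the sum is an isomorphism by the five lemma,
    because the sum is exact. *)
Lemma dist_sum D D' :
  distinguished D -> distinguished D' -> distinguished (tri_sum D D').
Proof.
move=> dD dD'.
have [C [i [q dC]]] := dist_ex (dsumm (tf D) (tf D')).
have sq1 : prj1 (tY D) (tY D') ∘ dsumm (tf D) (tf D') =
    tf D ∘ prj1 (tX D) (tX D').
  by rewrite /= /dsumm /colm !catE.
have [c1 [_ /= ci1 cq1]] := dist_mor dC dD sq1.
have sq2 : prj2 (tY D) (tY D') ∘ dsumm (tf D) (tf D') =
    tf D' ∘ prj2 (tX D) (tX D').
  by rewrite /= /dsumm /colm !catE.
have [c2 [_ /= ci2 cq2]] := dist_mor dC dD' sq2.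
apply: dist_iso (dC).
exists (idm _), (idm _), (colm c1 c2); split; [split=> /=|exact: idm_iso ..|].
- by rewrite !catE.
- by rewrite /colm /dsumm /colm !catE -!compA ci1 ci2.
- by apply: eq_to_Sdsum; rewrite /dsumS /rowm /colm !suspE ?cq1 ?cq2.
have [exY exC _] := dist_exact3 dD; have [exY' exC' _] := dist_exact3 dD'.
apply: (five_lemma dC (i' := dsumm (ti D) (ti D')) (q' := dsumS (tq D) (tq D'))).
- exact: (sum_is_triangle (dist_is_triangle dD) (dist_is_triangle dD')).
- exact: exact_dsumm.
- exact: exact_dsumS.
- by rewrite /colm /dsumm /colm !catE -!compA ci1 ci2.
- by apply: eq_to_Sdsum; rewrite /dsumS /rowm /colm !suspE ?cq1 ?cq2.
Qed.

Lemma dist_id2 X : distinguished (tri_id2 X).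
Proof.
apply/dist_rotP; apply: dist_iso (dist_id1 X).
exists (idm _), (idm _), 0; split; [split=> /=|exact: idm_iso ..|].
- by rewrite !catE.
- by rewrite !catE.
- by rewrite !suspE.
- exact: zero_iso (zob_is_zero T) (susp_is_zero (zob_is_zero T)).
Qed.

Lemma dist_id3 X : distinguished (tri_id3 X).
Proof.
apply: dist_iso ((dist_rotP _).1 (@dist_id1 T X)).
exists (idm _), (idm _), (- idm _); split; [split=> /=|exact: idm_iso ..|].
- by rewrite !catE.
- by rewrite !suspE.
- by rewrite !suspE.
- exact/opp_iso/idm_iso.
Qed.

Lemma dist_contractible (A B C : T) : distinguished (contractible A B C).
Proof.
by apply: dist_sum (dist_id3 C); apply: dist_sum (dist_id1 A) (dist_id2 B).
Qed.

(** A biproduct decomposition of the middle object, given by the retraction [r]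
    and the section [p], is the sum of two contractible triangles. *)
Lemma dist_split A B W (u : arr A W) (v : arr W B) (r : arr W A) (p : arr B W) :
  r ∘ u = idm A -> v ∘ p = idm B -> v ∘ u = 0 -> r ∘ p = 0 ->
  u ∘ r + p ∘ v = idm W -> distinguished (Triangle u v 0).
Proof.
move=> ru vp vu rp decomp.
have z1 := zob_is_zero T.
apply: dist_iso (dist_sum (dist_id1 A) (dist_id2 B)).
exists (prj1 _ _), (rowm u p), (prj2 _ _); split; [split=> /=| | | ].
- by apply: eq_dsum; rewrite /rowm /dsumm /colm !catE.
- by apply: eq_dsum; rewrite /rowm /dsumm /colm !catE ?vu ?vp.
- by rewrite /dsumS /rowm !suspE.
- exact: prj1_zero_iso.
- exists (colm r v); split; last by rewrite /rowm /colm !catE.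
  apply: eq_dsum; rewrite /rowm /colm !catE -?compA ?ru ?vp ?vu ?rp !catE //.
- exact: prj2_zero_iso.
Qed.

Lemma dist_split1 X Y : distinguished (tri_split1 X Y).
Proof.
by apply: (@dist_split _ _ _ _ _ (prj1 X Y) (incl2 X Y));
  rewrite ?catE ?dsum_id.
Qed.

Lemma dist_split2 X Y : distinguished (tri_split2 X Y).
Proof.
by apply: (@dist_split _ _ _ _ _ (prj2 X Y) (incl1 X Y));
  rewrite ?catE // addrC dsum_id.
Qed.

(** ** Sums of octahedra *)

Lemma oct_sum_comm X Y Z X' Y' Z' (f : arr X Y) (g : arr Y Z)
    (f' : arr X' Y') (g' : arr Y' Z') (O : octa f g) (O' : octa f' g') :
  oct_comm O -> oct_comm O' -> oct_comm (oct_sum O O').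
Proof.
move=> [a b c d] [a' b' c' d']; split=> /=.
- by rewrite !dsumm_comp a a'.
- by rewrite dsumS_dsumm b b'.
- by rewrite !dsumm_comp c c'.
- by rewrite dsumS_dsumm susp_dsummS d d'.
Qed.

Lemma oct_sum_gf X Y Z X' Y' Z' (f : arr X Y) (g : arr Y Z)
    (f' : arr X' Y') (g' : arr Y' Z') (O : octa f g) (O' : octa f' g') :
  oct_gf (oct_sum O O') = tri_sum (oct_gf O) (oct_gf O').
Proof. by rewrite /oct_gf dsumm_comp. Qed.

Lemma oct_sum_t X Y Z X' Y' Z' (f : arr X Y) (g : arr Y Z)
    (f' : arr X' Y') (g' : arr Y' Z') (O : octa f g) (O' : octa f' g') :
  oct_t (oct_sum O O') = tri_sum (oct_t O) (oct_t O').
Proof. by rewrite /oct_t /= susp_dsummS. Qed.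

Lemma oct_sum_faces (P : triangle T -> Prop) X Y Z X' Y' Z' (f : arr X Y)
    (g : arr Y Z) (f' : arr X' Y') (g' : arr Y' Z') (O : octa f g)
    (O' : octa f' g') :
  (forall D D', P D -> P D' -> P (tri_sum D D')) ->
  oct_faces O P -> oct_faces O' P -> oct_faces (oct_sum O O') P.
Proof.
move=> PS [a b c d] [a' b' c' d']; split; [exact: PS a a'|exact: PS b b'| |].
- by rewrite oct_sum_gf; exact: PS c c'.
- by rewrite oct_sum_t; exact: PS d d'.
Qed.

(** The two extra triangles of a sum are, up to interchange and the comparison
    of sums with suspension, the sums of the extra triangles. *)
Lemma oct_sum_special X Y Z X' Y' Z' (f : arr X Y) (g : arr Y Z)
    (f' : arr X' Y') (g' : arr Y' Z') (O : octa f g) (O' : octa f' g') :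
  special_octahedron O -> special_octahedron O' ->
  special_octahedron (oct_sum O O').
Proof.
move=> [[[tO cO] dO] s1 s2] [[[tO' cO'] dO'] s1' s2']; split.
- split; last exact: oct_sum_faces dist_sum dO dO'.
  split; last exact: oct_sum_comm.
  exact: oct_sum_faces (@sum_is_triangle T) tO tO'.
- apply: dist_iso (dist_sum s1 s1').
  exists (idm _), (midm _ _ _ _), (idm _).
  split; [split=> /=|exact: idm_iso|exact: midm_iso|exact: idm_iso].
  + by apply: eq_dsum; rewrite /midm /rowm /dsumm /colm !catE.
  + by apply: eq_dsum; apply: eq_dsum; rewrite /midm /rowm /dsumm /colm !catE.
  + by rewrite suspm1 comp1m compm1 dsumS_dsumm.
- apply: dist_iso (dist_sum s2 s2').
  exists (idm _), (dsumm (dsum_susp _ _) (idm _) ∘ midm _ _ _ _), (dsum_susp _ _).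
  split; [split=> /=|exact: idm_iso| |exact: dsum_susp_iso].
  + by apply: eq_dsum;
      rewrite /dsum_susp /midm /dsumS /rowm /dsumm /colm !suspE.
  + by apply: eq_dsum; apply: eq_dsum;
      rewrite /dsum_susp /midm /dsumS /rowm /dsumm /colm !suspE.
  + by apply: eq_dsum;
      rewrite /dsum_susp /midm /dsumS /rowm /dsumm /colm !suspE.
  + apply: comp_iso (midm_iso _ _ _ _).
    by apply: dsumm_iso (idm_iso _); exact: dsum_susp_iso.
Qed.

(** ** Degenerate octahedra *)

Section Degenerate.

Variables (D : triangle T).

Lemma oct_deg0_gf : oct_gf (oct_deg0 D) = tri_id2 (tY D).
Proof. by rewrite /oct_gf compm0. Qed.
Lemma oct_deg0_t : oct_t (oct_deg0 D) = D.
Proof. by rewrite /oct_t /= suspm1 comp1m; case: D. Qed.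
Lemma oct_deg1_g : oct_g (oct_deg1 D) = D. Proof. by case: D. Qed.
Lemma oct_deg1_gf : oct_gf (oct_deg1 D) = D.
Proof. by rewrite /oct_gf compm1; case: D. Qed.
Lemma oct_deg1_t : oct_t (oct_deg1 D) = tri_id2 (tC D).
Proof. by rewrite /oct_t /= suspm0 comp0m. Qed.
Lemma oct_deg0_g : oct_g (oct_deg0 D) = D. Proof. by case: D. Qed.
Lemma oct_deg2_f : oct_f (oct_deg2 D) = D. Proof. by case: D. Qed.
Lemma oct_deg2_gf : oct_gf (oct_deg2 D) = D.
Proof. by rewrite /oct_gf comp1m; case: D. Qed.
Lemma oct_deg2_t : oct_t (oct_deg2 D) = tri_id1 (tC D).
Proof. by rewrite /oct_t /= compm0. Qed.

Definition oct_degE :=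
  (oct_deg0_g, oct_deg0_gf, oct_deg0_t, oct_deg1_g, oct_deg1_gf, oct_deg1_t,
   oct_deg2_f, oct_deg2_gf, oct_deg2_t).

Lemma oct_deg0_faces (P : triangle T -> Prop) :
  P (tri_id2 (tX D)) -> P (tri_id2 (tY D)) -> P D -> oct_faces (oct_deg0 D) P.
Proof. by split; rewrite ?oct_degE. Qed.

Lemma oct_deg1_faces (P : triangle T -> Prop) :
  P (tri_id1 (tX D)) -> P (tri_id2 (tC D)) -> P D -> oct_faces (oct_deg1 D) P.
Proof. by split; rewrite ?oct_degE. Qed.

Lemma oct_deg2_faces (P : triangle T -> Prop) :
  P (tri_id1 (tY D)) -> P (tri_id1 (tC D)) -> P D -> oct_faces (oct_deg2 D) P.
Proof. by split; rewrite ?oct_degE. Qed.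

Hypothesis tD : is_triangle D.

Lemma oct_deg0_comm : oct_comm (oct_deg0 D).
Proof. by case: tD => ? qi ?; split; rewrite /= ?suspE. Qed.

Lemma oct_deg1_comm : oct_comm (oct_deg1 D).
Proof. by case: tD => iff ? ?; split; rewrite /= ?suspE. Qed.

Lemma oct_deg2_comm : oct_comm (oct_deg2 D).
Proof. by case: tD => ? ? fq; split; rewrite /= ?suspE. Qed.

End Degenerate.

Section DegenerateSpecial.

Variables (D : triangle T).
Hypothesis dD : distinguished D.

Let tD := dist_is_triangle dD.
Let dRR := (dist_rotP _).1 ((dist_rotP _).1 dD).

Lemma ordinary_of_faces X Y Z (f : arr X Y) (g : arr Y Z) (O : octa f g) :
  oct_comm O -> oct_faces O distinguished -> ordinary_octahedron O.
Proof.
move=> cO dO; split=> //; split=> //.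
by case: dO => *; split; exact: dist_is_triangle.
Qed.

(** For each degenerate octahedron, one of the two extra triangles is split and
    the other is, up to signs and a zero summand, [D] or a rotation of [D]. *)
Lemma oct_deg0_special : special_octahedron (oct_deg0 D).
Proof.
have [fi qi fq] := tD; split.
- apply: ordinary_of_faces (oct_deg0_comm tD) _.
  by apply: oct_deg0_faces => //; exact: dist_id2.
- rewrite /oct_sq1 /= qi.
  apply: (@dist_split _ _ _ _ _ (- prj2 _ _) (incl1 _ _));
    rewrite /colm /rowm !catE ?subrr //.
  by rewrite addrC addrA addrK dsum_id.
- apply: dist_iso ((dist_rotP _).1 dD).
  exists (- idm _), (incl2 _ _), (idm _).
  split; [split=> /=|exact/opp_iso/idm_iso| |exact: idm_iso].
  + by rewrite /colm !catE.
  + by rewrite /rowm !catE.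
  + by rewrite !suspE.
  + exact/incl2_zero_iso/susp_is_zero/zob_is_zero.
Qed.

Lemma oct_deg1_special : special_octahedron (oct_deg1 D).
Proof.
have z1 := zob_is_zero T; have [fi qi fq] := tD; split.
- apply: ordinary_of_faces (oct_deg1_comm tD) _.
  by apply: oct_deg1_faces => //; [exact: dist_id1 | exact: dist_id2].
- apply: dist_iso (dD).
  exists (idm _), (incl1 _ _), (idm _).
  split; [split=> /=|exact: idm_iso|exact: incl1_zero_iso|exact: idm_iso].
  + by rewrite /colm !catE.
  + by rewrite /rowm !catE.
  + by rewrite !suspE.
- rewrite /oct_sq2 /= compm0 suspm0.
  apply: (@dist_split _ _ _ _ _ (- prj2 _ _) (incl1 _ _));
    rewrite /colm /rowm !suspE ?subrr //.
  by rewrite addrC addrA addrK dsum_id.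
Qed.

Lemma oct_deg2_special : special_octahedron (oct_deg2 D).
Proof.
have z1 := zob_is_zero T; have [fi qi fq] := tD; split.
- apply: ordinary_of_faces (oct_deg2_comm tD) _.
  by apply: oct_deg2_faces => //; exact: dist_id1.
- rewrite /oct_sq1 /= compm0.
  apply: (@dist_split _ _ _ _ _ (prj1 _ _) (incl2 _ _));
    rewrite /colm /rowm !suspE ?subrr //.
  by rewrite addrA subrK dsum_id.
- apply: dist_iso dRR.
  exists (idm _), (incl1 _ _), (- idm _).
  split; [split=> /=|exact: idm_iso|exact: incl1_zero_iso|exact/opp_iso/idm_iso].
  + by rewrite /colm !catE.
  + by rewrite /rowm !catE.
  + by rewrite !suspE.
Qed.

End DegenerateSpecial.
End Distinguished.

(** * Closure properties of decorated triangles and octahedra *)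

Section SharpClosure.

Variables (T : triangulatedCategory) (s : sharp T).
Implicit Types D : triangle T.

Lemma tri_iso_is_triangle D D' :
  tri_iso D D' -> is_triangle D -> is_triangle D'.
Proof.
move=> [a [b [c [[m1 m2 m3] [a' [_ aa']] [b' [_ bb']] [c' [_ cc']]]]]] [e1 e2 e3].
split.
- rewrite -[LHS]compm1 -aa' compA -(compA _ _ a) -m1 !compA -m2.
  by rewrite -(compA c) e1 compm0 comp0m.
- rewrite -[LHS]compm1 -bb' compA -(compA _ _ b) -m2 !compA -m3.
  by rewrite -(compA (suspm a)) e2 compm0 comp0m.
- rewrite -[LHS]compm1 -cc' compA -(compA _ _ c) -m3 !compA -suspmM -m1 suspmM.
  by rewrite -(compA (suspm b)) e3 compm0 comp0m.
Qed.

(** A distinguished triangle stays distinguished after adding a contractible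
    one, so nothing has to be modified. *)
Lemma virtual_dist D : distinguished D -> virtual_triangle D.
Proof.
move=> dD; split; first exact: dist_is_triangle.
exists zob, zob, zob; have dS := dist_sum dD (dist_contractible (@zob T) zob zob).
do 3!eexists; do 6!eexists; split; first exact: tri_iso_refl.
by split; exact: dS.
Qed.

Lemma virtual_iso D D' :
  tri_iso D D' -> virtual_triangle D -> virtual_triangle D'.
Proof.
move=> iDD' [tD [A [B [C [X [Y [Z [f [f' [i [i' [q [q' [iso dd]]]]]]]]]]]]]].
split; first exact: tri_iso_is_triangle iDD' tD.
exists A, B, C, X, Y, Z, f, f', i, i', q, q'; split=> //.
apply: tri_iso_trans iso; apply: tri_sum_iso (tri_iso_refl _).
exact: tri_iso_sym.
Qed.

(** Adding the two stabilizations and regrouping gives a stabilization of the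
    sum; each of the modified triangles is a sum of distinguished ones. *)
Lemma virtual_sum D D' :
  virtual_triangle D -> virtual_triangle D' -> virtual_triangle (tri_sum D D').
Proof.
move=> [tD [A [B [C [X [Y [Z [f [f1 [i [i1 [q [q1 [iso [d1 d2 d3]]]]]]]]]]]]]]].
move=> [tD' [A' [B' [C' [X' [Y' [Z' [f' [f1' [i' [i1' [q' [q1'
  [iso' [d1' d2' d3']]]]]]]]]]]]]]].
split; first exact: sum_is_triangle.
exists (A ⊕ A'), (B ⊕ B'), (C ⊕ C'), (X ⊕ X'), (Y ⊕ Y'), (Z ⊕ Z').
exists (dsumm f f'), (dsumm f1 f1'), (dsumm i i'), (dsumm i1 i1'),
  (dsumS q q'), (dsumS q1 q1'); split; last first.
  by split; [exact: dist_sum d1 d1' | exact: dist_sum d2 d2' |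
             exact: dist_sum d3 d3'].
apply: tri_iso_trans (tri_sum_iso iso iso').
apply: tri_iso_trans (tri_sum_mid _ _ _ _).
apply: tri_sum_iso (tri_iso_refl _) _.
exact/tri_iso_sym/contractible_sum.
Qed.

Lemma sharp_dist D : distinguished D -> sharp_triangle s D.
Proof. by case: s => //=; exact: virtual_dist. Qed.

Lemma sharp_tri_iso D D' :
  tri_iso D D' -> sharp_triangle s D -> sharp_triangle s D'.
Proof. by case: s => [|||st]; [| |exact: virtual_iso|]; exact: dist_iso. Qed.

Lemma sharp_sum D D' :
  sharp_triangle s D -> sharp_triangle s D' -> sharp_triangle s (tri_sum D D').
Proof. by case: s => [|||st]; [| |exact: virtual_sum|]; exact: dist_sum. Qed.

Lemma sharp_oct_faces (X Y Z : T) (f : arr X Y) (g : arr Y Z) (O : octa f g) :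
  sharp_octahedron s O -> oct_faces O (sharp_triangle s).
Proof. by case: s => [|||st] /=; [case|case; case| case|case/sdist_ordinary]. Qed.

Lemma sharp_oct_sum (X Y Z X' Y' Z' : T) (f : arr X Y) (g : arr Y Z)
    (f' : arr X' Y') (g' : arr Y' Z') (O : octa f g) (O' : octa f' g') :
  sharp_octahedron s O -> sharp_octahedron s O' ->
  sharp_octahedron s (oct_sum O O').
Proof.
case: s => [|||st]; last exact: sdist_sum; last first.
- move=> [[tO cO] vO] [[tO' cO'] vO']; split.
    split; last exact: oct_sum_comm.
    exact: oct_sum_faces (@sum_is_triangle T) tO tO'.
  exact: oct_sum_faces virtual_sum vO vO'.
- exact: oct_sum_special.
- move=> [[tO cO] dO] [[tO' cO'] dO']; apply: ordinary_of_faces.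
    exact: oct_sum_comm.
  exact: oct_sum_faces (@dist_sum T) dO dO'.
Qed.

Lemma virtual_of_faces (X Y Z : T) (f : arr X Y) (g : arr Y Z) (O : octa f g) :
  oct_comm O -> oct_faces O (@virtual_triangle T) -> virtual_octahedron O.
Proof.
by move=> cO vO; split=> //; split=> //; case: vO => - [? _] [? _] [? _] [? _].
Qed.

Lemma sharp_deg0 D : sharp_triangle s D -> sharp_octahedron s (oct_deg0 D).
Proof.
case: s => [|||st] /= hD; last exact: sdist_deg0.
- by case: (oct_deg0_special hD).
- exact: oct_deg0_special.
- apply: virtual_of_faces; first by apply: oct_deg0_comm; case: hD.
  by apply: oct_deg0_faces => //; exact/virtual_dist/dist_id2.
Qed.

Lemma sharp_deg1 D : sharp_triangle s D -> sharp_octahedron s (oct_deg1 D).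
Proof.
case: s => [|||st] /= hD; last exact: sdist_deg1.
- by case: (oct_deg1_special hD).
- exact: oct_deg1_special.
- apply: virtual_of_faces; first by apply: oct_deg1_comm; case: hD.
  apply: oct_deg1_faces => //; apply: virtual_dist; first exact: dist_id1.
  exact: dist_id2.
Qed.

Lemma sharp_deg2 D : sharp_triangle s D -> sharp_octahedron s (oct_deg2 D).
Proof.
case: s => [|||st] /= hD; last exact: sdist_deg2.
- by case: (oct_deg2_special hD).
- exact: oct_deg2_special.
- apply: virtual_of_faces; first by apply: oct_deg2_comm; case: hD.
  by apply: oct_deg2_faces => //; exact/virtual_dist/dist_id1.
Qed.

Lemma sharp_id1 (X : T) : sharp_triangle s (tri_id1 X).
Proof. exact/sharp_dist/dist_id1. Qed.
Lemma sharp_id2 (X : T) : sharp_triangle s (tri_id2 X).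
Proof. exact/sharp_dist/dist_id2. Qed.
Lemma sharp_split1 (X Y : T) : sharp_triangle s (tri_split1 X Y).
Proof. exact/sharp_dist/dist_split1. Qed.
Lemma sharp_split2 (X Y : T) : sharp_triangle s (tri_split2 X Y).
Proof. exact/sharp_dist/dist_split2. Qed.

End SharpClosure.

(** * Equations in abelian groups *)

Section ZmodReflection.

Variable V : zmodType.

Inductive zexp := ZVar of nat | ZZero | ZAdd of zexp & zexp | ZOpp of zexp.

Fixpoint zeval (env : seq V) e : V :=
  match e with
  | ZVar n => nth 0 env n
  | ZZero => 0
  | ZAdd e1 e2 => zeval env e1 + zeval env e2
  | ZOpp e1 => - zeval env e1
  end.

Fixpoint zcoef e (i : nat) : int :=
  match e with
  | ZVar n => (n == i)%:Z
  | ZZero => 0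
  | ZAdd e1 e2 => zcoef e1 i + zcoef e2 i
  | ZOpp e1 => - zcoef e1 i
  end.

Lemma zevalE env e : zeval env e = \sum_(i < size env) env`_i *~ zcoef e i.
Proof.
elim: e => [n||e1 IH1 e2 IH2|e1 IH] /=.
- case: (ltnP n (size env)) => [lt|ge].
    rewrite (bigD1 (Ordinal lt)) //= eqxx mulr1z big1 ?addr0 // => i.
    by rewrite -val_eqE eq_sym /= => /negbTE ->; rewrite mulr0z.
  rewrite nth_default // big1 // => i _.
  by rewrite gtn_eqF ?mulr0z // (leq_trans (ltn_ord i)).
- by rewrite big1 // => i _; rewrite mulr0z.
- by rewrite IH1 IH2 -big_split; apply: eq_bigr => i _; rewrite mulrzDr.
- by rewrite IH -sumrN; apply: eq_bigr => i _; rewrite mulrNz.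
Qed.

Lemma zmod_reflect env e1 e2 :
  all (fun i => zcoef e1 i == zcoef e2 i) (iota 0 (size env)) ->
  zeval env e1 = zeval env e2.
Proof.
move=> /allP h; rewrite !zevalE; apply: eq_bigr => i _.
by rewrite (eqP (h i _)) // mem_iota /=.
Qed.

End ZmodReflection.

Ltac zlookup x env :=
  lazymatch env with
  | x :: _ => constr:(0%N)
  | _ :: ?env' => let n := zlookup x env' in constr:(S n)
  end.
Ltac zmem x env :=
  lazymatch env with
  | nil => constr:(false)
  | x :: _ => constr:(true)
  | _ :: ?env' => zmem x env'
  end.
Ltac zvars e env :=
  lazymatch e with
  | ?a + ?b => let env1 := zvars a env in zvars b env1
  | - ?a => zvars a env
  | 0 => env
  | _ => lazymatch zmem e env with
         | true => env
         | false => constr:(e :: env)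
         end
  end.
Ltac zreify e env :=
  lazymatch e with
  | ?a + ?b => let a' := zreify a env in let b' := zreify b env in
               constr:(ZAdd a' b')
  | - ?a => let a' := zreify a env in constr:(ZOpp a')
  | 0 => constr:(ZZero)
  | _ => let n := zlookup e env in constr:(ZVar n)
  end.

(** Decides equations that hold in every abelian group. *)
Ltac zmod :=
  lazymatch goal with
  | |- @eq ?V ?l ?r =>
    let env := zvars l (@nil V) in
    let env := zvars r env in
    let l' := zreify l env in
    let r' := zreify r env in
    apply: (@zmod_reflect _ env l' r'); vm_compute; reflexivity
  end.

(** * Stable quadratic modules modulo brackets *)

Section GroupMorphisms.

Local Open Scope group_scope.

Variables (G H : groupType) (f : G -> H).
Hypothesis fM : {morph f : x y / x * y}.

Lemma morph_unit : f 1 = 1.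
Proof. by apply: (mulgI (f 1)); rewrite -fM !mulg1. Qed.

Lemma morph_inv x : f x^-1 = (f x)^-1.
Proof. by apply: (mulgI (f x)); rewrite -fM !mulgV morph_unit. Qed.

End GroupMorphisms.

Section StableQuadraticModules.

Local Open Scope group_scope.

Variable C : stableQuadraticModule.
Implicit Types (a b c : sqm0 C) (x y z k : sqm1 C).

Definition bd1 := morph_unit (@bdM C).
Definition bdV := morph_inv (@bdM C).

Lemma br1l b : br 1 b = 1 :> sqm1 C. Proof. exact: morph_unit (@brMl C b). Qed.
Lemma brVl a b : br a^-1 b = (br a b)^-1 :> sqm1 C.
Proof. exact: morph_inv (@brMl C b) a. Qed.
Lemma br1r a : br a 1 = 1 :> sqm1 C. Proof. exact: morph_unit (@brMr C a). Qed.

Lemma br_inv a b : (br a b)^-1 = br b a.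
Proof. by apply: (mulgI (br a b)); rewrite mulgV br_skew. Qed.

(** Expand [br (a * a') (b' * b)] in the two possible orders. *)
Lemma br_comm a b a' b' : commute (br a b) (br a' b').
Proof.
have /= e1 := brMl (b' * b) a a'; have /= e2 := brMr (a * a') b' b.
move: e2; rewrite e1 !brMr !brMl -!mulgA => /mulgI.
by rewrite !mulgA => /mulIg.
Qed.

(** The commutator of [x] and [br a b] is the bracket of [bd x] and a commutator,
    and the latter vanishes because values of the bracket commute. *)
Lemma br_central a b x : commute (br a b) x.
Proof.
apply/commgP/eqP; rewrite -br_bd bd_br.
have brR c : br c [~ b, a] = 1.
  rewrite /commg /conjg !brMr !(morph_inv (brMr c)).
  by rewrite (br_comm c b c a) mulKg mulVg.
exact: brR.
Qed.

(** The commutator of [k] and [x] is the bracket of [bd x] and [bd k]. *)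
Lemma ker_central k x : bd k = 1 -> commute k x.
Proof. by move=> k1; apply/commgP/eqP; rewrite -br_bd k1 br1r. Qed.

(** ** Brackets *)

Definition brprod (L : seq (sqm0 C * sqm0 C)) : sqm1 C :=
  foldr (fun p x => br p.1 p.2 * x) 1 L.

Lemma brprod_cat L L' : brprod (L ++ L') = brprod L * brprod L'.
Proof. by elim: L => [|p L IH] /=; rewrite ?mul1g // IH mulgA. Qed.

Lemma brprod_central L x : commute (brprod L) x.
Proof.
elim: L => [|p L IH] /=; first exact/commute_sym/commute1.
by apply/commute_sym/commuteM; apply: commute_sym; [exact: br_central | exact: IH].
Qed.

Lemma brprodV L : (brprod L)^-1 = brprod [seq (p.2, p.1) | p <- L].
Proof.
elim: L => [|p L IH] /=; first exact: invg1.
by rewrite invgM IH br_inv; apply: brprod_central.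
Qed.

Definition bracketed x := exists L, x = brprod L.

Lemma bracketed1 : bracketed 1. Proof. by exists [::]. Qed.
Lemma bracketed_br a b : bracketed (br a b).
Proof. by exists [:: (a, b)]; rewrite /= mulg1. Qed.
Lemma bracketedM x y : bracketed x -> bracketed y -> bracketed (x * y).
Proof. by move=> [L ->] [L' ->]; exists (L ++ L'); rewrite brprod_cat. Qed.
Lemma bracketedV x : bracketed x -> bracketed x^-1.
Proof. by move=> [L ->]; rewrite brprodV; eexists. Qed.
Lemma bracketed_central x y : bracketed x -> commute x y.
Proof. by move=> [L ->]; exact: brprod_central. Qed.

Local Open Scope quotient_scope.

Definition modbr : rel (sqm1 C) := fun x y => `[< bracketed (x^-1 * y) >].

Fact modbr_equiv : equiv_class_of modbr.
Proof.
split=> [x|x y|y x z].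
- by apply/asboolP; rewrite mulVg; exact: bracketed1.
- by apply/asboolP/asboolP => /bracketedV; rewrite invgM invgK.
- move=> /asboolP xy /asboolP yz; apply/asboolP.
  by have := bracketedM xy yz; rewrite !mulgA mulgK.
Qed.

Canonical modbr_equiv_rel := EquivRelPack modbr_equiv.

(** The abelian group [sqm1 C] modulo brackets; it is abelian because every
    commutator is a bracket of boundaries. *)
Definition ab1 := {eq_quot modbr}.
HB.instance Definition _ := Choice.on ab1.

Definition toab (x : sqm1 C) : ab1 := \pi_{eq_quot modbr} x.
Definition repab (v : ab1) : sqm1 C := repr (v : {eq_quot modbr}).

Lemma toabP x y : toab x = toab y <-> bracketed (x^-1 * y).
Proof. by split=> [/eqmodP/asboolP //|?]; apply/eqmodP/asboolP. Qed.

Lemma repabK : cancel repab toab. Proof. exact: reprK. Qed.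

Lemma repabP x : bracketed ((repab (toab x))^-1 * x).
Proof. by apply/toabP; rewrite repabK. Qed.

Definition ab1_add (v w : ab1) := toab (repab v * repab w).
Definition ab1_opp (v : ab1) := toab (repab v)^-1.

Fact toab_mul x y : toab (x * y) = ab1_add (toab x) (toab y).
Proof.
apply/esym/toabP; rewrite invgM -mulgA (mulgA _ x).
rewrite (bracketed_central _ (repabP x)) mulgA.
exact: bracketedM (repabP y) (repabP x).
Qed.

Fact toab_inv x : toab x^-1 = ab1_opp (toab x).
Proof.
apply/toabP; rewrite invgK; have := repabP x.
set r := repab _ => rx; have -> : x * r^-1 = r * (r^-1 * x) * r^-1.
  by rewrite mulVKg.
by rewrite -(bracketed_central r rx) mulgK.
Qed.

Fact ab1_addC : commutative ab1_add.
Proof.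
move=> v w; rewrite -[v]repabK -[w]repabK -!toab_mul; apply/toabP.
move: (repab v) (repab w) => x y.
have -> : (x * y)^-1 * (y * x) = [~ y, x].
  by rewrite invgM commgEl /conjg !mulgA.
by rewrite -br_bd; exact: bracketed_br.
Qed.

Fact ab1_addA : associative ab1_add.
Proof.
by move=> u v w; rewrite -[u]repabK -[v]repabK -[w]repabK -!toab_mul mulgA.
Qed.
Fact ab1_add0 : left_id (toab 1) ab1_add.
Proof. by move=> v; rewrite -[v]repabK -toab_mul mul1g. Qed.
Fact ab1_addN : left_inverse (toab 1) ab1_opp ab1_add.
Proof. by move=> v; rewrite -[v]repabK -toab_inv -toab_mul mulVg. Qed.

HB.instance Definition _ := GRing.isZmodule.Build ab1
  ab1_addA ab1_addC ab1_add0 ab1_addN.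

Lemma toab1 : toab 1 = 0%R. Proof. by []. Qed.
Lemma toabM x y : toab (x * y) = (toab x + toab y)%R.
Proof. exact: toab_mul. Qed.
Lemma toabV x : toab x^-1 = (- toab x)%R.
Proof. exact: toab_inv. Qed.
Lemma toab_br a b : toab (br a b) = 0%R.
Proof.
by rewrite -toab1; apply/toabP; rewrite br_inv mulg1; exact: bracketed_br.
Qed.

End StableQuadraticModules.

(** * Nilpotent groups detecting degree 0 *)

Section NilpotentTarget.

Local Open Scope group_scope.

Variable G : groupType.
Hypothesis nil2 : forall a b c : G, commute [~ a, b] c.

Fact nil2_commMr (a b c : G) : [~ c, a * b] = [~ c, a] * [~ c, b].
Proof.
apply: (mulgI (a * b * c)); rewrite -commgC [LHS]mulgA [c * a]commgC.
rewrite -[LHS]mulgA (nil2 c a b) [LHS]mulgA -(mulgA a c b) [c * b]commgC.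
by rewrite (nil2 c a [~ c, b]) !mulgA.
Qed.

Fact nil2_commMl (a b c : G) : [~ a * b, c] = [~ a, c] * [~ b, c].
Proof. by rewrite -[LHS]invgR nil2_commMr invgM !invgR nil2. Qed.

(** With the identity as boundary, the axioms force the bracket to be the
    commutator, and they hold because the group has class at most two. *)
Definition nil2Sqm : stableQuadraticModule.
Proof.
apply: (@StableQuadraticModule G G id (fun a b => [~ b, a])) => //=.
- by move=> c a b; exact: nil2_commMr.
- by move=> c a b; rewrite nil2_commMl.
- by move=> a b; rewrite -[[~ a, b]]invgR mulgV.
Defined.

Variables (T : triangulatedCategory) (s : sharp T) (phi : T -> G).
Hypothesis phi0 : phi zob = 1.

Definition nil2_gen1 (g : Dgen1 s) : G :=
  match g with
  | DIso X X' h _ => (phi X')^-1 * phi X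
  | DTri D _ => (phi (tY D))^-1 * phi (tC D) * phi (tX D)
  end.

(** In [nil2Sqm] an element is its own boundary, so every generator of degree 1
    must go to the value of its boundary. The defining relations then hold
    because their two sides have the same boundary in a group of class two. *)
Lemma nil2_sat : @satisfies (Dpres s) nil2Sqm phi nil2_gen1.
Proof.
have act (x a : G) : x * [~ x, a] = a^-1 * x * a.
  by rewrite /commg /conjg mulVKg !mulgA.
split.
- by move=> u v [X X' h Hh|D HD|].
- move=> x y [] /=.
  + by move=> X _; rewrite mulVg.
  + by move=> X _; rewrite phi0 mulg1 mulVg.
  + by move=> X _; rewrite phi0 mulg1 mulVg.
  + by move=> X Y Z k h _ _ _; rewrite mulgA mulgK.
  + move=> D D' _ _ a b c _ _ _ _; rewrite act !invgM invgK.
    by rewrite !mulgA !mulgK.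
  + move=> X Y Z f g O _ _ _ _ _ /=; rewrite act.
    by rewrite !mulgA !mulgK.
  + move=> X Y _ _; rewrite !invgM invgK /commg /conjg !mulgA.
    by rewrite mulgK.
Qed.

(** Degree 0 of the module is thus as free as a group of class two can be:
    values on objects may be prescribed, up to the zero object. *)
Lemma nil2_detect :
  exists F : sqm0 (Dstar s) -> G,
    {morph F : a b / a * b} /\
    forall X, F (cls0 (Gen0 X : word0 (gen0 (Dpres s)) _)) = phi X.
Proof.
have [F [[F0 _] _]] := presentedSqm_universal nil2_sat.
by exists (mor0 F); split; [exact: (@mor0M _ _ F) | exact: F0].
Qed.

End NilpotentTarget.

Section Heisenberg.

(** The integral Heisenberg group of unitriangular matrices: its first two
    coordinates count objects, and the third detects commutators. *)
Definition heis : Type := (int * int * int)%type.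

Definition heis_mul (u v : heis) : heis :=
  (u.1.1 + v.1.1, u.1.2 + v.1.2, u.2 + v.2 + u.1.1 * v.1.2).
Definition heis_inv (u : heis) : heis :=
  (- u.1.1, - u.1.2, - u.2 + u.1.1 * u.1.2).

HB.instance Definition _ := Choice.on heis.

Fact heis_mulA : associative heis_mul.
Proof.
by move=> [[a b] c] [[a' b'] c'] [[a'' b''] c'']; rewrite /heis_mul /=;
  congr (_, _, _); ring.
Qed.
Fact heis_mul1 : left_id ((0, 0, 0) : heis) heis_mul.
Proof. by move=> [[a b] c]; rewrite /heis_mul /=; congr (_, _, _); ring. Qed.
Fact heis_1mul : right_id ((0, 0, 0) : heis) heis_mul.
Proof. by move=> [[a b] c]; rewrite /heis_mul /=; congr (_, _, _); ring. Qed.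
Fact heis_mulV : left_inverse ((0, 0, 0) : heis) heis_inv heis_mul.
Proof. by move=> [[a b] c]; rewrite /heis_mul /heis_inv /=; congr (_, _, _); ring. Qed.
Fact heis_Vmul : right_inverse ((0, 0, 0) : heis) heis_inv heis_mul.
Proof. by move=> [[a b] c]; rewrite /heis_mul /heis_inv /=; congr (_, _, _); ring. Qed.

HB.instance Definition _ := isGroup.Build heis
  heis_mulA heis_mul1 heis_1mul heis_mulV heis_Vmul.

Lemma heisM (u v : heis) : (u * v)%g = heis_mul u v. Proof. by []. Qed.
Lemma heisV (u : heis) : (u^-1)%g = heis_inv u. Proof. by []. Qed.

Lemma heis_comm (u v : heis) :
  [~ u, v]%g = (0, 0, u.1.1 * v.1.2 - v.1.1 * u.1.2) :> heis.
Proof.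
case: u v => [[a b] c] [[a' b'] c']; rewrite /commg /conjg !heisM !heisV.
by rewrite /heis_mul /heis_inv /=; congr (_, _, _); ring.
Qed.

Lemma heis_nil2 (u v w : heis) : commute [~ u, v]%g w.
Proof.
rewrite heis_comm; case: w => [[a b] c]; rewrite /commute !heisM.
by rewrite /heis_mul /=; congr (_, _, _); ring.
Qed.

End Heisenberg.

(** * The class of a direct sum of triangles *)

Section Presented.

Variables (T : triangulatedCategory) (s : sharp T).
Implicit Types (X Y Z A B : T) (D : triangle T).

Local Notation M := (Dstar s).
Local Notation sharpT := (sharp_triangle s).

Definition obcl X : sqm0 M := @cls0 (Dpres s) (gOb s X).

(** The classes of triangles and isomorphisms as total functions, so that
    equations between triangles can be rewritten under them. *)
Definition tcl D : sqm1 M :=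
  if pselect (sharpT D) is left H then tri_class H else 1%g.
Definition icl X Y (h : arr X Y) : sqm1 M :=
  if pselect (is_iso h) is left H then @cls1 (Dpres s) (gIso s H) else 1%g.

Lemma tclE D (H : sharpT D) : tcl D = tri_class H.
Proof.
by rewrite /tcl; case: pselect => // H'; rewrite (Prop_irrelevance H' H).
Qed.

Lemma iclE X Y (h : arr X Y) (H : is_iso h) : icl h = @cls1 (Dpres s) (gIso s H).
Proof.
by rewrite /icl; case: pselect => // H'; rewrite (Prop_irrelevance H' H).
Qed.

Lemma rel0E (u v : word0 (gen0 (Dpres s)) (gen1 (Dpres s))) :
  Drel0 u v -> @cls0 (Dpres s) u = cls0 v.
Proof. by move=> h; apply/cls0P/cong0_rel. Qed.
Lemma rel1E (x y : word1 (gen0 (Dpres s)) (gen1 (Dpres s))) :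
  Drel1 x y -> @cls1 (Dpres s) x = cls1 y.
Proof. by move=> h; apply/cls1P/cong1_rel. Qed.

Lemma cls0_bdE (x : word1 (gen0 (Dpres s)) (gen1 (Dpres s))) :
  @cls0 (Dpres s) (Bd x) = bd (cls1 x : sqm1 M).
Proof. exact: cls0_bd. Qed.
Lemma cls1_brE (u v : word0 (gen0 (Dpres s)) (gen1 (Dpres s))) :
  @cls1 (Dpres s) (Br u v) = br (cls0 u : sqm0 M) (cls0 v : sqm0 M).
Proof. exact: cls1_br. Qed.

Definition act (x : sqm1 M) (a : sqm0 M) : sqm1 M := (x * br a (bd x))%g.

Lemma cls1_actE (x : word1 (gen0 (Dpres s)) (gen1 (Dpres s))) u :
  @cls1 (Dpres s) (actw x u) = act (cls1 x) (cls0 u).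
Proof. by rewrite cls1_mul cls1_brE cls0_bdE. Qed.

Lemma obcl0 : obcl zob = 1%g.
Proof. exact: rel0E (Drel_zob s). Qed.

Lemma bd_icl X Y (h : arr X Y) :
  is_iso h -> bd (icl h) = ((obcl Y)^-1 * obcl X)%g.
Proof.
move=> H; rewrite (iclE H) -cls0_bdE (rel0E (Drel_bd_iso s H)).
by rewrite cls0_mul cls0_inv.
Qed.

Lemma bd_tcl D : sharpT D ->
  bd (tcl D) = ((obcl (tY D))^-1 * obcl (tC D) * obcl (tX D))%g.
Proof.
move=> H; rewrite (tclE H) -cls0_bdE (rel0E (Drel_bd_tri H)).
by rewrite !cls0_mul cls0_inv.
Qed.

Lemma icl_id X : icl (idm X) = 1%g.
Proof. by rewrite (iclE (idm_iso X)); exact: rel1E (Drel_idm _ _). Qed.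

Lemma icl_comp X Y Z (k : arr Y Z) (h : arr X Y) :
  is_iso k -> is_iso h -> icl (k ∘ h) = (icl k * icl h)%g.
Proof.
move=> Hk Hh; have Hkh := comp_iso Hk Hh.
rewrite (iclE Hk) (iclE Hh) (iclE Hkh).
by rewrite (rel1E (Drel_comp s Hk Hh Hkh)) cls1_mul.
Qed.

Lemma tcl_id1 X : tcl (tri_id1 X) = 1%g.
Proof. by rewrite (tclE (sharp_id1 s X)); exact: rel1E (Drel_id1 _). Qed.
Lemma tcl_id2 X : tcl (tri_id2 X) = 1%g.
Proof. by rewrite (tclE (sharp_id2 s X)); exact: rel1E (Drel_id2 _). Qed.

Lemma tcl_iso D D' (a : arr (tX D) (tX D')) (b : arr (tY D) (tY D'))
    (c : arr (tC D) (tC D')) :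
  sharpT D -> sharpT D' -> @tri_mor T D D' a b c ->
  is_iso a -> is_iso b -> is_iso c ->
  (icl a * act (icl c) (obcl (tX D)) = (tcl D')^-1 * icl b * tcl D)%g.
Proof.
move=> H H' m Ha Hb Hc; rewrite (tclE H) (tclE H') (iclE Ha) (iclE Hb) (iclE Hc).
have := rel1E (Drel_tri_iso H H' Ha Hb Hc m).
by rewrite cls1_mul cls1_actE !cls1_mul cls1_inv.
Qed.

Lemma tcl_oct X Y Z (f : arr X Y) (g : arr Y Z) (O : octa f g) :
  sharp_octahedron s O ->
  (tcl (oct_g O) * tcl (oct_f O) =
   tcl (oct_gf O) * act (tcl (oct_t O)) (obcl X))%g.
Proof.
move=> HO; have [Hf Hg Hgf Ht] := sharp_oct_faces HO.
have e := rel1E (Drel_oct Hf Hg Hgf Ht HO).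
rewrite (tclE Hf) (tclE Hg) (tclE Hgf) (tclE Ht) -[LHS]cls1_mul.
by rewrite [LHS]e cls1_mul cls1_actE.
Qed.

Lemma tcl_br X Y :
  br (obcl X) (obcl Y) = ((tcl (tri_split2 X Y))^-1 * tcl (tri_split1 X Y))%g.
Proof.
have H1 := sharp_split1 s X Y; have H2 := sharp_split2 s X Y.
rewrite (tclE H1) (tclE H2) -cls1_brE (rel1E (Drel_br H1 H2)).
by rewrite cls1_mul cls1_inv.
Qed.

(** Comparison with [X = X -> 0], whose class vanishes. Thus triangles alone
    generate degree 1. *)
Lemma icl_tcl X Y (h : arr X Y) : is_iso h ->
  distinguished (Triangle h (0 : arr Y zob) (0 : arr zob (susp X))) /\
  icl h = tcl (Triangle h (0 : arr Y zob) (0 : arr zob (susp X))).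
Proof.
move=> Hh; pose D := Triangle h (0 : arr Y zob) (0 : arr zob (susp X)).
have m : @tri_mor T (tri_id1 X) D (idm X) h (idm zob).
  by split; rewrite /= ?suspE.
have dD : distinguished D.
  apply: dist_iso (dist_id1 X); exists (idm X), h, (idm zob).
  by split=> //; exact: idm_iso.
split=> //; have := tcl_iso (sharp_id1 s X) (sharp_dist s dD) m
  (idm_iso _) Hh (idm_iso _).
rewrite !icl_id tcl_id1 /act bd1 br1r !mulg1 => e.
by apply: (mulgI (tcl D)^-1%g); rewrite -e mulVg.
Qed.

(** ** Classes modulo brackets *)

Definition tab D := toab (tcl D).
Definition iab X Y (h : arr X Y) := toab (icl h).

Lemma toab_act x y a : toab (x * act y a)%g = toab x + toab y.
Proof. by rewrite !toabM toab_br addr0. Qed.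

Lemma iab_id X : iab (idm X) = 0. Proof. by rewrite /iab icl_id. Qed.
Lemma iab_comp X Y Z (k : arr Y Z) (h : arr X Y) :
  is_iso k -> is_iso h -> iab (k ∘ h) = iab k + iab h.
Proof. by move=> Hk Hh; rewrite /iab icl_comp // toabM. Qed.

Lemma iab_inv X Y (k : arr Y X) (h : arr X Y) :
  k ∘ h = idm X -> h ∘ k = idm Y -> iab k = - iab h.
Proof.
move=> kh hk; have e : iab k + iab h = 0.
  by rewrite -iab_comp ?kh ?iab_id //; [exists h | exists k].
by apply/eqP; rewrite -addr_eq0 e.
Qed.

Lemma tab_iso D D' (a : arr (tX D) (tX D')) (b : arr (tY D) (tY D'))
    (c : arr (tC D) (tC D')) :
  sharpT D -> @tri_mor T D D' a b c -> is_iso a -> is_iso b -> is_iso c ->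
  sharpT D' /\ tab D' = tab D + iab b - iab a - iab c.
Proof.
move=> H m Ha Hb Hc; have H' : sharpT D'.
  by apply: sharp_tri_iso H; exists a, b, c.
split=> //; have := congr1 (@toab M) (tcl_iso H H' m Ha Hb Hc).
rewrite toab_act !toabM toabV.
rewrite -/(tab D) -/(tab D') -/(iab a) -/(iab b) -/(iab c) => e.
rewrite -[RHS]addrA -opprD e; zmod.
Qed.

Lemma tab_oct X Y Z (f : arr X Y) (g : arr Y Z) (O : octa f g) :
  sharp_octahedron s O ->
  tab (oct_g O) + tab (oct_f O) = tab (oct_gf O) + tab (oct_t O).
Proof. by move=> /tcl_oct /(congr1 (@toab M)); rewrite toab_act toabM. Qed.

Lemma tab_split2 X Y : tab (tri_split2 X Y) = tab (tri_split1 X Y).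
Proof.
have := congr1 (@toab M) (tcl_br X Y); rewrite toab_br toabM toabV => /eqP.
by rewrite eq_sym addrC subr_eq0 => /eqP.
Qed.

(** The correction terms: [X + Y] differs from the formal sum of [X] and [Y] by
    the boundary of this class. By [tab_split2] the other split triangle on [X] and
    [Y] gives the same correction, because brackets vanish. *)
Definition sab X Y := tab (tri_split1 X Y).

Lemma tab_id1_id2 A B :
  tab (tri_sum (tri_id1 A) (tri_id2 B)) =
  sab A B - iab (incl1 A zob) - iab (incl2 zob B).
Proof.
have z1 := zob_is_zero T.
have [|_ ->] := @tab_iso (tri_split1 A B) (tri_sum (tri_id1 A) (tri_id2 B))
  (incl1 A zob) (idm _) (incl2 zob B) (sharp_split1 s A B) _
  (incl1_zero_iso A z1) (idm_iso _) (incl2_zero_iso B z1).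
  by split; rewrite /= /dsumS /dsumm /colm /rowm !suspE.
by rewrite iab_id addr0.
Qed.

Lemma tab_id2_id1 A B :
  tab (tri_sum (tri_id2 A) (tri_id1 B)) =
  sab A B - iab (incl1 A zob) - iab (incl2 zob B).
Proof.
have z1 := zob_is_zero T.
have [|_ ->] := @tab_iso (tri_split2 A B) (tri_sum (tri_id2 A) (tri_id1 B))
  (incl2 zob B) (idm _) (incl1 A zob) (sharp_split2 s A B) _
  (incl2_zero_iso B z1) (idm_iso _) (incl1_zero_iso A z1).
  by split; rewrite /= /dsumS /dsumm /colm /rowm !suspE.
by rewrite iab_id addr0 tab_split2; rewrite -/(sab A B) /=; zmod.
Qed.

Lemma sum_zero_mor D :
  @tri_mor T D (tri_sum D (tri_id1 zob)) (incl1 _ _) (incl1 _ _) (incl1 _ _) /\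
  @tri_mor T D (tri_sum (tri_id1 zob) D) (incl2 _ _) (incl2 _ _) (incl2 _ _).
Proof. by split; split; rewrite /= /dsumS /dsumm /colm /rowm !suspE. Qed.

Lemma tab_sum_zero D : sharpT D ->
  tab (tri_sum D (tri_id1 zob)) =
    tab D + iab (incl1 (tY D) zob) - iab (incl1 (tX D) zob)
          - iab (incl1 (tC D) zob) /\
  tab (tri_sum (tri_id1 zob) D) =
    tab D + iab (incl2 zob (tY D)) - iab (incl2 zob (tX D))
          - iab (incl2 zob (tC D)).
Proof.
move=> H; have z1 := zob_is_zero T; have [m1 m2] := sum_zero_mor D.
have n1 A := incl1_zero_iso A z1; have n2 A := incl2_zero_iso A z1.
split; first by have [] := tab_iso H m1 (n1 _) (n1 _) (n1 _).
by have [] := tab_iso H m2 (n2 _) (n2 _) (n2 _).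
Qed.

Lemma tab_oct_sum X Y Z X' Y' Z' (f : arr X Y) (g : arr Y Z)
    (f' : arr X' Y') (g' : arr Y' Z') (O : octa f g) (O' : octa f' g') :
  sharp_octahedron s O -> sharp_octahedron s O' ->
  tab (tri_sum (oct_g O) (oct_g O')) + tab (tri_sum (oct_f O) (oct_f O')) =
  tab (tri_sum (oct_gf O) (oct_gf O')) + tab (tri_sum (oct_t O) (oct_t O')).
Proof.
move=> HO HO'; have := tab_oct (sharp_oct_sum HO HO').
by rewrite oct_sum_gf oct_sum_t.
Qed.

(** The base of the octahedron for [e1] is [X1 + X2 -> Y1 + X2 -> Y1 + Y2]; it is
    the sum of a degenerate octahedron of [D1] and one of [D2], and it reduces
    the claim to sums with a triangle [B = B -> 0]. These are evaluated by two
    more sums of degenerate octahedra, [e2] and [e3], in which only sums of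
    contractible triangles and sums with a zero triangle remain. *)
Lemma tab_sum D1 D2 : sharpT D1 -> sharpT D2 ->
  tab (tri_sum D1 D2) = tab D1 + tab D2 + sab (tY D1) (tY D2)
    - sab (tX D1) (tX D2) - sab (tC D1) (tC D2).
Proof.
move=> H1 H2; set X1 := tX D1; set Y1 := tY D1; set X2 := tX D2; set Y2 := tY D2.
have e1 : tab (tri_sum (tri_id1 Y1) D2) + tab (tri_sum D1 (tri_id1 X2)) =
    tab (tri_sum D1 D2) + tab (tri_sum (tri_id1 (tC D1)) (tri_id2 (tC D2))).
  by have := tab_oct_sum (sharp_deg2 H1) (sharp_deg1 H2); rewrite !oct_degE.
have e2 : tab (tri_sum D1 (tri_id1 X2)) + tab (tri_sum (tri_id2 X1) (tri_id1 X2)) =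
    tab (tri_sum (tri_id2 Y1) (tri_id1 X2)) + tab (tri_sum D1 (tri_id1 zob)).
  have := tab_oct_sum (sharp_deg0 H1) (sharp_deg2 (sharp_id1 s X2)).
  by rewrite !oct_degE.
have e3 : tab (tri_sum (tri_id1 Y1) D2) + tab (tri_sum (tri_id1 Y1) (tri_id2 X2)) =
    tab (tri_sum (tri_id1 Y1) (tri_id2 Y2)) + tab (tri_sum (tri_id1 zob) D2).
  have := tab_oct_sum (sharp_deg2 (sharp_id1 s Y1)) (sharp_deg0 H2).
  by rewrite !oct_degE.
have [z1 _] := tab_sum_zero H1; have [_ z2] := tab_sum_zero H2.
rewrite (canRL (addrK _) (esym e1)) (canRL (addrK _) e2) (canRL (addrK _) e3).
rewrite z1 z2.
rewrite !tab_id1_id2 !tab_id2_id1 -/X1 -/X2 -/Y1 -/Y2; zmod.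
Qed.

(** ** Finite direct sums *)

Definition osum (l : seq T) : T := foldr (@dsum T) zob l.

(** Modulo brackets, the class whose boundary compares [osum l] with the formal
    sum of the objects of [l]. *)
Fixpoint sums (l : seq T) : ab1 M :=
  if l is A :: l' then sab A (osum l') + sums l' else 0.

Lemma sab_zero_l B : sab zob B = iab (incl2 zob B).
Proof.
have m : @tri_mor T (tri_id2 B) (tri_split1 zob B) (idm _) (incl2 _ _) (idm _).
  by split; rewrite /= ?suspE //; exact/esym/from_zero/zob_is_zero.
have [_ e] := tab_iso (sharp_id2 s B) m (idm_iso _)
  (incl2_zero_iso B (zob_is_zero T)) (idm_iso _).
by rewrite /sab e !iab_id !subr0 /tab tcl_id2 toab1 add0r.
Qed.

Lemma sab_zero_r A : sab A zob = iab (incl1 A zob).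
Proof.
have m : @tri_mor T (tri_id1 A) (tri_split1 A zob) (idm _) (incl1 _ _) (idm _).
  by split; rewrite /= ?suspE //; exact/esym/to_zero/zob_is_zero.
have [_ e] := tab_iso (sharp_id1 s A) m (idm_iso _)
  (incl1_zero_iso A (zob_is_zero T)) (idm_iso _).
by rewrite /sab e !iab_id !subr0 /tab tcl_id1 toab1 add0r.
Qed.

Lemma iab_prj1 A : iab (prj1 A zob) = - iab (incl1 A zob).
Proof.
apply: iab_inv; first exact: prj1_incl1.
by rewrite -dsum_id (to_zero (prj2 A zob) (zob_is_zero T)) !catE.
Qed.

Lemma iab_prj2 A : iab (prj2 zob A) = - iab (incl2 zob A).
Proof.
apply: iab_inv; first exact: prj2_incl2.
by rewrite -dsum_id (to_zero (prj1 zob A) (zob_is_zero T)) !catE.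
Qed.

Lemma sab_map A B B' (h : arr B B') : is_iso h ->
  sab A B' = sab A B + iab (dsumm (idm A) h) - iab h.
Proof.
move=> Hh; have m : @tri_mor T (tri_split1 A B) (tri_split1 A B')
    (idm A) (dsumm (idm A) h) h.
  by split; rewrite /= /dsumm /colm !suspE.
have [_ e] := tab_iso (sharp_split1 s A B) m (idm_iso _)
  (dsumm_iso (idm_iso A) Hh) Hh.
by rewrite /sab e iab_id subr0.
Qed.

Definition assocm A B C : arr ((A ⊕ B) ⊕ C) (A ⊕ (B ⊕ C)) :=
  rowm (dsumm (idm A) (incl1 B C)) (incl2 A (B ⊕ C) ∘ incl2 B C).

Lemma assocm_iso A B C : is_iso (assocm A B C).
Proof.
exists (rowm (incl1 (A ⊕ B) C ∘ incl1 A B) (dsumm (incl2 A B) (idm C))).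
by split; do ?apply: eq_dsum;
  rewrite /assocm /rowm /dsumm /colm !catE.
Qed.

(** Apply [tab_sum] to the sum of [A -> A + B -> B] with [0 -> C = C], which is
    isomorphic to the split triangle on [A] and [B + C] by reassociation. *)
Lemma sab_assoc A B C :
  sab A (B ⊕ C) + sab B C = sab A B + sab (A ⊕ B) C + iab (assocm A B C).
Proof.
have z1 := zob_is_zero T.
have H := sharp_sum (sharp_split1 s A B) (sharp_id2 s C).
have m : @tri_mor T (tri_sum (tri_split1 A B) (tri_id2 C)) (tri_split1 A (B ⊕ C))
    (prj1 A zob) (assocm A B C) (idm _).
  split; rewrite /= /assocm /dsumS /dsumm /colm /rowm; [|by rewrite !suspE..].
  by apply: eq_dsum; rewrite !catE.
have [_ e] := tab_iso H m (prj1_zero_iso A z1) (assocm_iso A B C) (idm_iso _).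
rewrite {1}/sab e tab_sum; [|exact: sharp_split1|exact: sharp_id2].
rewrite /= /tab tcl_id2 toab1 iab_id iab_prj1 sab_zero_r.
by rewrite -/(tab _) -/(sab A B); zmod.
Qed.

Definition rotm A B C : arr (B ⊕ (A ⊕ C)) (A ⊕ (B ⊕ C)) :=
  rowm (incl2 A (B ⊕ C) ∘ incl1 B C) (dsumm (idm A) (incl2 B C)).

Lemma rotmK A B C : rotm A B C ∘ rotm B A C = idm _.
Proof.
by do ?apply: eq_dsum; rewrite /rotm /rowm /dsumm /colm !catE.
Qed.

Lemma rotm_iso A B C : is_iso (rotm A B C).
Proof. by exists (rotm B A C); rewrite !rotmK. Qed.

(** The same computation for the sum of [0 -> B = B] with
    [A -> A + C -> C]. *)
Lemma sab_swap A B C :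
  sab A (B ⊕ C) + sab B C = sab B (A ⊕ C) + sab A C + iab (rotm A B C).
Proof.
have z1 := zob_is_zero T.
have H := sharp_sum (sharp_id2 s B) (sharp_split1 s A C).
have m : @tri_mor T (tri_sum (tri_id2 B) (tri_split1 A C)) (tri_split1 A (B ⊕ C))
    (prj2 zob A) (rotm A B C) (idm _).
  split; rewrite /= /rotm /dsumS /dsumm /colm /rowm; [|by rewrite !suspE..].
  by apply: eq_dsum; rewrite !catE.
have [_ e] := tab_iso H m (prj2_zero_iso A z1) (rotm_iso A B C) (idm_iso _).
rewrite {1}/sab e tab_sum; [|exact: sharp_id2|exact: sharp_split1].
rewrite /= /tab tcl_id2 toab1 iab_id iab_prj2 sab_zero_l.
by rewrite -/(tab _) -/(sab A C); zmod.
Qed.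

End Presented.

(** * Arbitrary elements modulo brackets *)

Section SplitSeq.

Variables (K : Type) (g : K -> int).

Lemma split_neg (L : seq K) : \sum_(x <- L) g x < 0 ->
  exists L1 x L2, L = L1 ++ x :: L2 /\ g x < 0.
Proof.
elim: L => [|y L IH]; first by rewrite big_nil ltxx.
rewrite big_cons; case: (ltrP (g y) 0) => gy; first by exists [::], y, L.
move=> h; have [|L1 [x [L2 [-> gx]]]] := IH.
  by apply: le_lt_trans h; rewrite lerDr.
by exists (y :: L1), x, L2.
Qed.

End SplitSeq.

Section Lists.

Variables (T : triangulatedCategory) (s : sharp T).
Implicit Types (X Y Z A B : T) (D : triangle T) (l p n : seq T).

Local Notation M := (Dstar s).
Local Notation sharpT := (sharp_triangle s).

Local Notation iab := (iab s).
Local Notation sab := (sab s).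
Local Notation sums := (sums s).
Local Notation tab := (tab s).
Local Notation obcl := (obcl s).
Local Notation tcl := (tcl s).

Lemma sums_cat l1 l2 : exists h : arr (osum l1 ⊕ osum l2) (osum (l1 ++ l2)),
  is_iso h /\
  sums (l1 ++ l2) = sab (osum l1) (osum l2) + sums l1 + sums l2 + iab h.
Proof.
elim: l1 => [|A l1 [h [Hh e]]].
  exists (prj2 _ _); split; first exact/prj2_zero_iso/zob_is_zero.
  by rewrite /= iab_prj2 sab_zero_l; zmod.
exists (dsumm (idm A) h ∘ assocm A (osum l1) (osum l2)).
have Hd := dsumm_iso (idm_iso A) Hh; have Ha := assocm_iso A (osum l1) (osum l2).
split; first exact: comp_iso.
rewrite (iab_comp _ Hd Ha) /= e (sab_map _ A Hh).
by rewrite (canRL (addrK _) (sab_assoc s A (osum l1) (osum l2))); zmod.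
Qed.

(** The class of the isomorphism has to be known, since isomorphisms of sums are
    not unique; those that permute summands have the class required here. *)
Definition leqv l l' := exists h : arr (osum l) (osum l'),
  is_iso h /\ sums l' = sums l + iab h.

Lemma leqv_refl l : leqv l l.
Proof. by exists (idm _); rewrite iab_id addr0; split=> //; exact: idm_iso. Qed.

Lemma leqv_trans l1 l2 l3 : leqv l1 l2 -> leqv l2 l3 -> leqv l1 l3.
Proof.
move=> [h [Hh e]] [k [Hk e']]; exists (k ∘ h); split; first exact: comp_iso.
by rewrite iab_comp // e' e; zmod.
Qed.

Lemma leqv_sym l1 l2 : leqv l1 l2 -> leqv l2 l1.
Proof.
move=> [h [[k [kh hk]] e]]; exists k; split; first by exists h.
by rewrite (iab_inv s kh hk) e addrK.
Qed.

Lemma leqv_cons A l l' : leqv l l' -> leqv (A :: l) (A :: l').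
Proof.
move=> [h [Hh e]]; exists (dsumm (idm A) h).
split; first exact: dsumm_iso (idm_iso A) Hh.
by rewrite /= e (sab_map s A Hh); zmod.
Qed.

Lemma leqv_zob l : leqv (zob :: l) l.
Proof.
exists (prj2 _ _); split; first exact/prj2_zero_iso/zob_is_zero.
by rewrite /= iab_prj2 sab_zero_l; zmod.
Qed.

Lemma leqv_swap A B l : leqv (B :: A :: l) (A :: B :: l).
Proof.
exists (rotm A B (osum l)); split; first exact: rotm_iso.
by rewrite /= addrA sab_swap; zmod.
Qed.

Lemma leqv_mid A l1 l2 : leqv (A :: l1 ++ l2) (l1 ++ A :: l2).
Proof.
elim: l1 => [|B l1 IH] /=; first exact: leqv_refl.
by apply: leqv_trans (leqv_swap _ _ _) _; exact: leqv_cons.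
Qed.

Definition ind A X : int := if pselect (X = A) then 1 else 0.

Lemma ind_ge0 A X : 0 <= ind A X.
Proof. by rewrite /ind; case: pselect. Qed.
Lemma ind_same A : ind A A = 1.
Proof. by rewrite /ind; case: pselect. Qed.
Lemma ind_neq A X : X <> A -> ind A X = 0.
Proof. by rewrite /ind; case: pselect. Qed.

(** The hypothesis says that every nonzero object has the same multiplicity in
    both lists; indicator functions locate the head of [l] in [l']. *)
Lemma leqv_multiset l l' :
  (forall phi : T -> int, phi zob = 0 ->
     \sum_(A <- l) phi A = \sum_(A <- l') phi A) -> leqv l l'.
Proof.
elim: l l' => [|A l IH] l'.
  elim: l' => [|B l' IH'] e; first exact: leqv_refl.
  have [B0|nB0] := pselect (B = zob).
    rewrite B0; apply: leqv_trans (IH' _) (leqv_sym (leqv_zob _)) => phi phi0.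
    by rewrite e // big_cons B0 phi0 add0r.
  have /eqP := e (ind B) (ind_neq (not_eq_sym nB0)).
  rewrite big_nil big_cons ind_same eq_sym gt_eqF // ltr_wpDr //.
  by apply: sumr_ge0 => i _; exact: ind_ge0.
have [-> e|nA0 e] := pselect (A = zob).
  apply: leqv_trans (leqv_zob _) (IH _ _) => phi phi0.
  by rewrite -e // big_cons phi0 add0r.
have [L1 [x [L2 [El' gx]]]] :
    exists L1 x L2, l' = L1 ++ x :: L2 /\ - ind A x < 0.
  apply: split_neg; rewrite sumrN -(e _ (ind_neq (not_eq_sym nA0))).
  rewrite big_cons ind_same oppr_lt0 ltr_wpDr //.
  by apply: sumr_ge0 => i _; exact: ind_ge0.
have xA : x = A.
  by apply: contrapT => xA; move: gx; rewrite ind_neq // oppr0 ltxx.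
rewrite El' xA; apply: leqv_trans (leqv_mid _ _ _); apply/leqv_cons/IH.
move=> phi phi0; apply: (addrI (phi A)); have := e phi phi0.
by rewrite El' xA !(big_cons, big_cat) /= => ->; zmod.
Qed.

(** ** Every element is, modulo brackets, a difference of two triangles *)

Definition additive_on0 (F : sqm0 M -> int) := forall a b, F (a * b)%g = F a + F b.

Lemma additive_on01 F : additive_on0 F -> F 1%g = 0.
Proof. by move=> FD; apply: (addrI (F 1%g)); rewrite -FD mulg1 addr0. Qed.

Lemma additive_on0V F a : additive_on0 F -> F (a^-1)%g = - F a.
Proof.
move=> FD; by apply/eqP; rewrite -addr_eq0 -FD mulVg (additive_on01 FD).
Qed.

(** The terms [tab D - sums p] are normalized so that their boundary involves the
    list [p] and the outer objects [X] and [C], but not the object [osum p].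
    Both triangles share [X] and [C], so the boundary of [x] only involves [p]
    and [n]; the last clause records it in every abelian quotient of degree 0.
    In this form the middle objects of the two triangles become isomorphic as
    soon as the boundary of [x] vanishes. *)
Definition presentable (x : sqm1 M) :=
  exists X C p n (f : arr X (osum p)) (i : arr (osum p) C) (q : arr C (susp X))
      (f' : arr X (osum n)) (i' : arr (osum n) C) (q' : arr C (susp X)),
  [/\ sharpT (Triangle f i q), sharpT (Triangle f' i' q'),
      toab x = (tab (Triangle f' i' q') - sums n)
               - (tab (Triangle f i q) - sums p)
    & forall F, additive_on0 F ->
        F (bd x) = \sum_(A <- p) F (obcl A) - \sum_(A <- n) F (obcl A)].

Lemma tab_transport X Y Y' C (f : arr X Y) (i : arr Y C) (q : arr C (susp X))
    (h : arr Y Y') : is_iso h -> sharpT (Triangle f i q) ->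
  exists (f' : arr X Y') (i' : arr Y' C), sharpT (Triangle f' i' q) /\
    tab (Triangle f' i' q) = tab (Triangle f i q) + iab h.
Proof.
move=> Hh H; have [k [kh hk]] := Hh; exists (h ∘ f), (i ∘ k).
have m : @tri_mor T (Triangle f i q) (Triangle (h ∘ f) (i ∘ k) q) (idm X) h (idm C).
  by split; rewrite /= ?suspE // -compA kh compm1.
by have [H' ->] := tab_iso H m (idm_iso X) Hh (idm_iso C); rewrite !iab_id !subr0.
Qed.

Lemma presentable0 x : toab x = 0 ->
  (forall F, additive_on0 F -> F (bd x) = 0) -> presentable x.
Proof.
move=> x0 Fx; exists zob, zob, [::], [::], (idm _), 0, 0, (idm _), 0, 0.
have H := sharp_id1 s (@zob T); split; [exact: H|exact: H|by rewrite subrr|].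
by move=> F FD; rewrite Fx // !big_nil subrr.
Qed.

Lemma presentableV x : presentable x -> presentable x^-1%g.
Proof.
move=> [X [C [p [n [f [i [q [f' [i' [q' [H H' e eF]]]]]]]]]]].
exists X, C, n, p, f', i', q', f, i, q; split=> //; first by rewrite toabV e; zmod.
by move=> F FD; rewrite bdV additive_on0V // eF // opprB.
Qed.

Lemma presentableM x y : presentable x -> presentable y -> presentable (x * y)%g.
Proof.
move=> [X [C [p [n [f [i [q [f' [i' [q' [H H' e eF]]]]]]]]]]].
move=> [X1 [C1 [p1 [n1 [f1 [i1 [q1 [f1' [i1' [q1' [H1 H1' e1 eF1]]]]]]]]]]].
have [h [Hh eh]] := sums_cat p p1; have [h' [Hh' eh']] := sums_cat n n1.
have [g [j [Hg eg]]] := tab_transport Hh (sharp_sum H H1).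
have [g' [j' [Hg' eg']]] := tab_transport Hh' (sharp_sum H' H1').
exists (X ⊕ X1), (C ⊕ C1), (p ++ p1), (n ++ n1).
exists g, j, (dsumS q q1), g', j', (dsumS q' q1'); split=> //.
  have t1 := tab_sum H H1; have t1' := tab_sum H' H1'; rewrite /tri_sum /= in t1 t1'.
  by rewrite toabM e e1 eg eg' t1 t1' eh eh'; zmod.
by move=> F FD; rewrite bdM FD eF // eF1 // !big_cat /= opprD addrACA.
Qed.

(** Up to zero summands, the positive triangle is [D], and the negative one is
    the split triangle on [C] and [X], whose normalized class is zero. *)
Lemma presentable_tcl D : sharpT D -> presentable (tcl D).
Proof.
case: D => X Y C f i q H; have z1 := zob_is_zero T.
have [f' [i' [H' e']]] := tab_transport (incl1_zero_iso Y z1) H.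
have [f2 [i2 [H2 e2]]] := tab_transport
  (dsumm_iso (idm_iso C) (incl1_zero_iso X z1)) (sharp_split2 s C X).
exists X, C, [:: C; X], [:: Y], f2, i2, 0, f', i', q; split=> //.
  rewrite e' e2 /= tab_split2 !sab_zero_r (sab_map s C (incl1_zero_iso X z1)).
  by rewrite -/(sab C X) -/(tab _) /=; zmod.
move=> F FD; rewrite bd_tcl // !FD additive_on0V // !big_cons !big_nil /=; zmod.
Qed.

Lemma all_presentable x : presentable x.
Proof.
rewrite -[x]rep1K; elim: (rep1 x) => {x} [[X X' h H|D H]||x Hx y Hy|x Hx|u v].
- have [dD e] := icl_tcl s H.
  have -> : @cls1 (Dpres s) (Gen1 (DIso s H)) = tcl (Triangle h (0 : arr X' zob) 0).
    by rewrite -e (iclE s H).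
  exact/presentable_tcl/sharp_dist.
- have -> : @cls1 (Dpres s) (Gen1 (DTri H)) = tcl D by rewrite (tclE H).
  exact: presentable_tcl.
- apply: presentable0; first exact: toab1.
  by move=> F FD; rewrite (_ : bd _ = 1%g) ?bd1 //; exact: additive_on01.
- by rewrite cls1_mul; exact: presentableM.
- by rewrite cls1_inv; exact: presentableV.
- rewrite cls1_brE; apply: presentable0; first exact: toab_br.
  move=> F FD; rewrite bd_br /commg /conjg !FD !additive_on0V //; zmod.
Qed.

End Lists.

(** * Brackets in the kernel and differences of triangles *)

Section Final.

Local Arguments br : simpl never.
Local Arguments bd : simpl never.

Variables (T : triangulatedCategory) (s : sharp T).
Implicit Types (X Y Z A B : T) (D : triangle T) (l p n : seq T).

Local Notation M := (Dstar s).
Local Notation sharpT := (sharp_triangle s).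
Local Notation tab := (tab s).
Local Notation obcl := (obcl s).
Local Notation tcl := (tcl s).

(** Degree 0 is generated by objects, as the boundaries of the generators of
    degree 1 are expressed in them. *)
Lemma degree0_ind (K : sqm0 M -> Prop) :
  K 1%g -> (forall a b, K a -> K b -> K (a * b)%g) ->
  (forall a, K a -> K (a^-1)%g) -> (forall X, K (obcl X)) -> forall a, K a.
Proof.
move=> K1 KM KV Kob a; rewrite -[a]rep0K; move: (rep0 a) => u {a}.
pose P0 (u : word0 (gen0 (Dpres s)) (gen1 (Dpres s))) := K (@cls0 (Dpres s) u).
pose P1 (x : word1 (gen0 (Dpres s)) (gen1 (Dpres s))) := K (@cls0 (Dpres s) (Bd x)).
have [h _] : (forall u, P0 u) /\ (forall x, P1 x); last exact: h.
apply: word_mut; rewrite /P0 /P1.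
- exact: Kob.
- exact: K1.
- by move=> v Kv w Kw; rewrite cls0_mul; exact: KM.
- by move=> v Kv; rewrite cls0_inv; exact: KV.
- by [].
- move=> [X X' h H|D H]; rewrite cls0_bdE.
    rewrite -(iclE s H) bd_icl //; apply: KM (Kob _); exact/KV/Kob.
  have -> : @cls1 (Dpres s) (Gen1 (DTri H)) = tcl D by rewrite (tclE H).
  rewrite bd_tcl //.
  exact: (KM _ _ (KM _ _ (KV _ (Kob _)) (Kob _)) (Kob _)).
- by rewrite cls0_bdE bd1.
- by move=> x Kx y Ky; rewrite cls0_bdE cls1_mul bdM -!cls0_bdE; exact: KM.
- by move=> x Kx; rewrite cls0_bdE cls1_inv bdV -cls0_bdE; exact: KV.
- move=> v Kv w Kw; rewrite cls0_bdE cls1_brE bd_br /commg /conjg.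
  exact: (KM _ _ (KV _ Kw) (KM _ _ (KV _ Kv) (KM _ _ Kw Kv))).
Qed.

Definition obpair (r : T * T) := (obcl r.1, obcl r.2).
Definition obbr (L : seq (T * T)) : sqm1 M := brprod (map obpair L).

Lemma obbr_cat L L' : obbr (L ++ L') = (obbr L * obbr L')%g.
Proof. by rewrite /obbr map_cat brprod_cat. Qed.

Lemma obbrV L : ((obbr L)^-1)%g = obbr [seq (r.2, r.1) | r <- L].
Proof. by rewrite /obbr brprodV -!map_comp. Qed.

Lemma obbr_br a b : exists L, br a b = obbr L.
Proof.
have M1 c : exists L, (1 : sqm1 M)%g = obbr L by exists [::].
have MM x y : (exists L, x = obbr L) -> (exists L, y = obbr L) ->
    exists L, (x * y)%g = obbr L.
  by move=> [L ->] [L' ->]; exists (L ++ L'); rewrite obbr_cat.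
have MV x : (exists L, x = obbr L) -> exists L, (x^-1)%g = obbr L.
  by move=> [L ->]; rewrite obbrV; eexists.
move: a; apply: degree0_ind => [|a a' Ka Ka'|a Ka|X].
- by exists [::]; rewrite br1l.
- by rewrite brMl; exact: MM.
- by rewrite brVl; exact: MV.
move: b; apply: degree0_ind => [|b b' Kb Kb'|b Kb|Y].
- by exists [::]; rewrite br1r.
- by rewrite brMr; exact: MM.
- by rewrite -br_inv brVl br_inv; exact: MV.
- by exists [:: (X, Y)]; rewrite /obbr /= mulg1.
Qed.

Lemma bracketed_obbr x : bracketed x -> exists L, x = obbr L.
Proof.
move=> [L ->]; elim: L => [|[a b] L [L' e]] /=; first by exists [::].
by have [L2 ->] := obbr_br a b; exists (L2 ++ L'); rewrite obbr_cat -e.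
Qed.

(** ** Brackets in the kernel of the boundary *)

Lemma heis_detect (phi psi : T -> int) : phi zob = 0 -> psi zob = 0 ->
  exists F : sqm0 M -> heis, {morph F : a b / (a * b)%g} /\
    forall X, F (obcl X) = (phi X, psi X, 0).
Proof.
move=> phi0 psi0.
have [|F [FM Fob]] := @nil2_detect heis heis_nil2 T s (fun X => (phi X, psi X, 0)).
  by rewrite phi0 psi0.
by exists F; split=> // X; exact: Fob.
Qed.

(** Multiplicities of nonzero objects are additive functions on degree 0. *)
Lemma ker_multiset (p n : seq T) :
  (forall F, @additive_on0 T s F ->
     \sum_(A <- p) F (obcl A) = \sum_(A <- n) F (obcl A)) ->
  forall phi : T -> int, phi zob = 0 ->
    \sum_(A <- p) phi A = \sum_(A <- n) phi A.
Proof.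
move=> e phi phi0; have [F [FM Fob]] := heis_detect phi0 phi0.
have := e (fun a => (F a).1.1) _; under eq_bigr do rewrite Fob /=.
under [in RHS]eq_bigr do rewrite Fob /=; apply.
by move=> a b; rewrite FM heisM.
Qed.

(** The Heisenberg group turns the boundary of a product of brackets into an
    alternating form, so that this form vanishes on the kernel. *)
Lemma obbr_ker_alt (L : seq (T * T)) (phi psi : T -> int) :
  phi zob = 0 -> psi zob = 0 -> bd (obbr L) = 1%g ->
  \sum_(r <- L) (phi r.1 * psi r.2 - phi r.2 * psi r.1) = 0.
Proof.
move=> phi0 psi0 L1; have [F [FM Fob]] := heis_detect phi0 psi0.
have FL : F (bd (obbr L)) =
    (0, 0, - \sum_(r <- L) (phi r.1 * psi r.2 - phi r.2 * psi r.1)).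
  elim: {L1} L => [|r L IH].
    by rewrite big_nil oppr0 /obbr /= bd1; exact: morph_unit FM.
  rewrite big_cons /obbr /= -/(obbr L) bdM FM IH bd_br /commg /conjg !FM.
  rewrite !(morph_inv FM) -/(conjg _ _) -/(commg _ _) heis_comm !Fob heisM.
  rewrite /heis_mul /=.
  by congr (_, _, _); ring.
have := congr1 (fun h : heis => h.2) FL; rewrite L1 (morph_unit FM) /=.
by move/esym/eqP; rewrite oppr_eq0 => /eqP.
Qed.

(** When the boundary vanishes, [obbr_ker_alt] with the indicator functions of
    [A] and [B] shows that a factor [(A, B)] with [A] and [B] distinct and
    nonzero is accompanied by a factor [(B, A)], and the two cancel. Brackets
    of an object with itself have trivial boundary and may survive. *)
Lemma obbr_ker (L : seq (T * T)) : bd (obbr L) = 1%g ->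
  exists N : seq T, obbr L = obbr [seq (A, A) | A <- N].
Proof.
have [k] := ubnP (size L); elim: k L => // k IH [|[A B] L] /=.
  by exists [::].
rewrite ltnS => ltk LL1.
have consE : obbr ((A, B) :: L) = (br (obcl A) (obcl B) * obbr L)%g by [].
have [AB|nAB] := pselect (A = B).
  have L1 : bd (obbr L) = 1%g.
    by move: LL1; rewrite consE AB bdM bd_br commgg mul1g.
  have [N e] := IH _ ltk L1; exists (B :: N).
  by rewrite consE AB e.
have [br1|nbr1] := pselect (br (obcl A) (obcl B) = 1%g).
  have [|N e] := IH L ltk; first by move: LL1; rewrite consE br1 mul1g.
  by exists N; rewrite consE br1 mul1g.
have nA : A <> zob by move=> A0; apply: nbr1; rewrite A0 obcl0 br1l.
have nB : B <> zob by move=> B0; apply: nbr1; rewrite B0 obcl0 br1r.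
pose g (r : T * T) := ind A r.1 * ind B r.2 - ind A r.2 * ind B r.1.
have gL : \sum_(r <- L) g r < 0.
  have := obbr_ker_alt (ind_neq (not_eq_sym nA)) (ind_neq (not_eq_sym nB)) LL1.
  rewrite big_cons !ind_same (ind_neq nAB) mulr1 mulr0 subr0 => e.
  by rewrite (_ : \sum_(r <- L) g r = -1) //; apply: (addrI 1); rewrite e subrr.
have [L1 [[A' B'] [L2 [EL]]]] := split_neg gL.
rewrite /g /=.
have [eA|nA'] := pselect (A' = B); last first.
  rewrite (ind_neq nA') mulr0 subr0 ltNge mulr_ge0 //; exact: ind_ge0.
have [eB|nB'] := pselect (B' = A); last first.
  rewrite (ind_neq nB') mul0r subr0 ltNge mulr_ge0 //; exact: ind_ge0.
move=> _.
have cancel : obbr ((A, B) :: L) = obbr (L1 ++ L2).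
  rewrite consE EL eA eB !obbr_cat.
  rewrite (_ : obbr ((B, A) :: L2) = (br (obcl B) (obcl A) * obbr L2)%g) //.
  rewrite (mulgA (obbr L1)) -(br_central _ _ (obbr L1)) -mulgA.
  by rewrite [LHS]mulgA br_skew mul1g.
have [||N e] := IH (L1 ++ L2).
- by move: ltk; rewrite EL !size_cat /=; apply: leq_trans; rewrite ltnS addnS.
- by rewrite -cancel.
by exists N; rewrite cancel.
Qed.

(** ** Differences of triangles on the same objects *)

Definition dif D D' : sqm1 M := ((tcl D)^-1 * tcl D')%g.
Definition parallel D D' := bd (tcl D) = bd (tcl D').

Lemma dif_refl D : dif D D = 1%g. Proof. exact: mulVg. Qed.

Lemma bd_dif D D' : parallel D D' -> bd (dif D D') = 1%g.
Proof. by rewrite /parallel /dif bdM bdV => ->; rewrite mulVg. Qed.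

Lemma tcl_dif D D' : tcl D' = (tcl D * dif D D')%g.
Proof. by rewrite /dif mulVKg. Qed.

Lemma act_ker x k a : bd k = 1%g -> act (x * k)%g a = (act x a * k)%g :> sqm1 M.
Proof.
move=> k1; rewrite /act bdM k1 mulg1 -!mulgA; congr (_ * _)%g.
exact: ker_central.
Qed.

Lemma parallel_objects D D' : sharpT D -> sharpT D' ->
  tX D = tX D' -> tY D = tY D' -> tC D = tC D' -> parallel D D'.
Proof. by move=> H H' eX eY eC; rewrite /parallel !bd_tcl // eX eY eC. Qed.

(** Differences of triangles on the same objects lie in the kernel of the
    boundary, hence are central and fixed by the action. They can therefore be
    factored out of the octahedral relation. *)
Lemma oct_dif X Y Z Y' Z' (f : arr X Y) (g : arr Y Z) (f' : arr X Y')
    (g' : arr Y' Z') (O : octa f g) (O' : octa f' g') :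
  sharp_octahedron s O -> sharp_octahedron s O' ->
  Y = Y' -> Z = Z' -> oCf O = oCf O' -> oCg O = oCg O' -> oCgf O = oCgf O' ->
  (dif (oct_g O) (oct_g O') * dif (oct_f O) (oct_f O') =
   dif (oct_gf O) (oct_gf O') * dif (oct_t O) (oct_t O'))%g.
Proof.
move=> HO HO' eY eZ eCf eCg eCgf.
have [Sf Sg Sgf St] := sharp_oct_faces HO.
have [Sf' Sg' Sgf' St'] := sharp_oct_faces HO'.
have pf := bd_dif (parallel_objects Sf Sf' erefl eY eCf).
have pg := bd_dif (parallel_objects Sg Sg' eY eZ eCg).
have pgf := bd_dif (parallel_objects Sgf Sgf' erefl eZ eCgf).
have pt := bd_dif (parallel_objects St St' eCf eCgf eCg).
have := tcl_oct HO'.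
rewrite (tcl_dif (oct_g O) (oct_g O')) (tcl_dif (oct_f O) (oct_f O')).
rewrite (tcl_dif (oct_gf O) (oct_gf O')) (tcl_dif (oct_t O) (oct_t O')).
rewrite (act_ker _ _ pt).
set kg := dif (oct_g O) _; set kf := dif (oct_f O) _.
set kgf := dif (oct_gf O) _; set kt := dif (oct_t O) _.
rewrite -mulgA (mulgA kg) (ker_central _ pg) -(mulgA _ kg) mulgA (tcl_oct HO).
rewrite -[in RHS]mulgA (mulgA kgf) (ker_central _ pgf) -(mulgA _ kgf).
rewrite [in RHS]mulgA.
by move=> /mulgI.
Qed.

(** The hypothesis is what the relations of two isomorphisms of triangles with
    the same components give. *)
Lemma dif_iso_eq D D' E E' (b : sqm1 M) : parallel D D' -> parallel E E' ->
  ((tcl E)^-1 * b * tcl D = (tcl E')^-1 * b * tcl D')%g -> dif E E' = dif D D'.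
Proof.
move=> /bd_dif pD /bd_dif pE.
rewrite (tcl_dif D D') (tcl_dif E E'); set k := dif D D'; set k' := dif E E'.
rewrite invgM -!mulgA => e; set u := ((tcl E)^-1 * (b * tcl D))%g in e.
apply: (mulgI u); rewrite -(ker_central u pE) -/k' [in LHS]e mulVKg.
by rewrite /u -!mulgA.
Qed.

Section Sums.

Variables (X1 Y1 C1 X2 Y2 C2 : T).
Variables (f1 g1 : arr X1 Y1) (i1 j1 : arr Y1 C1) (q1 r1 : arr C1 (susp X1)).
Variables (f2 g2 : arr X2 Y2) (i2 j2 : arr Y2 C2) (q2 r2 : arr C2 (susp X2)).
Local Notation D1 := (Triangle f1 i1 q1).
Local Notation E1 := (Triangle g1 j1 r1).
Local Notation D2 := (Triangle f2 i2 q2).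
Local Notation E2 := (Triangle g2 j2 r2).
Hypotheses (HD1 : sharpT D1) (HE1 : sharpT E1).
Hypotheses (HD2 : sharpT D2) (HE2 : sharpT E2).

Let z1 := zob_is_zero T.
Let H0 := sharp_id1 s (@zob T).
Let n1 A := incl1_zero_iso A z1.
Let n2 A := incl2_zero_iso A z1.

Lemma dif_sum_zero_r :
  dif (tri_sum D1 (tri_id1 zob)) (tri_sum E1 (tri_id1 zob)) = dif D1 E1.
Proof.
have [mD _] := sum_zero_mor D1; have [mE _] := sum_zero_mor E1.
have eD := tcl_iso HD1 (sharp_sum HD1 H0) mD (n1 _) (n1 _) (n1 _).
have eE := tcl_iso HE1 (sharp_sum HE1 H0) mE (n1 _) (n1 _) (n1 _).
by apply: dif_iso_eq (etrans (esym eD) eE);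
  apply: parallel_objects => //; exact: sharp_sum.
Qed.

Lemma dif_sum_zero_l :
  dif (tri_sum (tri_id1 zob) D2) (tri_sum (tri_id1 zob) E2) = dif D2 E2.
Proof.
have [_ mD] := sum_zero_mor D2; have [_ mE] := sum_zero_mor E2.
have eD := tcl_iso HD2 (sharp_sum H0 HD2) mD (n2 _) (n2 _) (n2 _).
have eE := tcl_iso HE2 (sharp_sum H0 HE2) mE (n2 _) (n2 _) (n2 _).
by apply: dif_iso_eq (etrans (esym eD) eE);
  apply: parallel_objects => //; exact: sharp_sum.
Qed.

Lemma dif_sum_id1_r B :
  dif (tri_sum D1 (tri_id1 B)) (tri_sum E1 (tri_id1 B)) = dif D1 E1.
Proof.
have HB := sharp_id1 s B.
have e := oct_dif (sharp_oct_sum (sharp_deg0 HD1) (sharp_deg2 HB))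
  (sharp_oct_sum (sharp_deg0 HE1) (sharp_deg2 HB)) erefl erefl erefl erefl erefl.
rewrite -dif_sum_zero_r; move: e; rewrite !oct_sum_gf !oct_sum_t !oct_degE.
by rewrite dif_refl mulg1 dif_refl mul1g.
Qed.

Lemma dif_sum_id1_l B :
  dif (tri_sum (tri_id1 B) D2) (tri_sum (tri_id1 B) E2) = dif D2 E2.
Proof.
have HB := sharp_id1 s B.
have e := oct_dif (sharp_oct_sum (sharp_deg2 HB) (sharp_deg0 HD2))
  (sharp_oct_sum (sharp_deg2 HB) (sharp_deg0 HE2)) erefl erefl erefl erefl erefl.
rewrite -dif_sum_zero_l; move: e; rewrite !oct_sum_gf !oct_sum_t !oct_degE.
by rewrite dif_refl mulg1 dif_refl mul1g.
Qed.

(** The octahedra are those of [tab_sum]. There is no correction term, because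
    the corrections depend only on the objects. *)
Lemma dif_sum : dif (tri_sum D1 D2) (tri_sum E1 E2) = (dif D1 E1 * dif D2 E2)%g.
Proof.
pose U := tri_sum (tri_id1 C1) (tri_id2 C2).
have e : (dif (tri_sum (tri_id1 Y1) D2) (tri_sum (tri_id1 Y1) E2) *
          dif (tri_sum D1 (tri_id1 X2)) (tri_sum E1 (tri_id1 X2)) =
          dif (tri_sum D1 D2) (tri_sum E1 E2) * dif U U)%g.
  have := oct_dif (sharp_oct_sum (sharp_deg2 HD1) (sharp_deg1 HD2))
    (sharp_oct_sum (sharp_deg2 HE1) (sharp_deg1 HE2))
    erefl erefl erefl erefl erefl.
  rewrite !oct_sum_gf !oct_sum_t !oct_degE (oct_deg2_gf E1) (oct_deg1_gf E2).
  by rewrite (oct_deg2_t E1) (oct_deg1_t E2).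
have p2 : bd (dif D2 E2) = 1%g by apply/bd_dif/parallel_objects.
move: e; rewrite dif_refl mulg1 => <-.
by rewrite dif_sum_id1_l dif_sum_id1_r (ker_central _ p2).
Qed.

End Sums.

Definition represented (x : sqm1 M) :=
  exists (X Y Z : T) (f f' : arr X Y) (i i' : arr Y Z) (q q' : arr Z (susp X)),
    [/\ sharpT (Triangle f i q), sharpT (Triangle f' i' q')
      & x = dif (Triangle f i q) (Triangle f' i' q')].

Lemma representedM x y : represented x -> represented y -> represented (x * y)%g.
Proof.
move=> [X [Y [Z [f [f' [i [i' [q [q' [H H' ->]]]]]]]]]].
move=> [X1 [Y1 [Z1 [f1 [f1' [i1 [i1' [q1 [q1' [H1 H1' ->]]]]]]]]]].
exists (X ⊕ X1), (Y ⊕ Y1), (Z ⊕ Z1), (dsumm f f1), (dsumm f' f1').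
exists (dsumm i i1), (dsumm i' i1'), (dsumS q q1), (dsumS q' q1').
split; [exact: sharp_sum H H1 | exact: sharp_sum H' H1' |].
exact/esym/dif_sum.
Qed.

(** The bracket of [A] with itself is the difference of the two split triangles
    [A -> A + A -> A], which have the same objects. *)
Lemma represented_squares N : represented (obbr [seq (A, A) | A <- N]).
Proof.
elim: N => [|A N IH].
  exists zob, zob, zob, (idm _), (idm _), 0, 0, 0, 0.
  have H := sharp_id1 s (@zob T).
  by split; rewrite ?dif_refl //; exact: H.
rewrite /= (_ : obbr _ =
  (br (obcl A) (obcl A) * obbr [seq (A, A) | A <- N])%g) //.
apply: representedM IH; rewrite tcl_br.
exists A, (A ⊕ A), A, (incl2 A A), (incl1 A A), (prj1 A A), (prj2 A A), 0, 0.
by split; [exact: sharp_split2 | exact: sharp_split1 |].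
Qed.

(** The presentation of [x] gives two triangles whose middle objects are sums of
    the same multiset of objects; transported to the same middle object, they
    represent [x] up to a product of brackets in the kernel of the boundary. *)
Lemma ker_represented x : bd x = 1%g -> represented x.
Proof.
move=> x1.
have [X [C [p [n [f [i [q [f' [i' [q' [H H' ex eF]]]]]]]]]]] := all_presentable x.
have [h [Hh eh]] : leqv s p n.
  apply: leqv_multiset; apply: ker_multiset => F FD; apply/eqP.
  rewrite -subr_eq0 -eF // x1.
  by rewrite additive_on01.
have [f2 [i2 [H2 e2]]] := tab_transport Hh H.
pose D := Triangle f2 i2 q; pose D' := Triangle f' i' q'.
have pD : parallel D D' by exact: parallel_objects.
have [L eL] : exists L, ((dif D D')^-1 * x)%g = obbr L.
  apply/bracketed_obbr/toabP; rewrite toabM toabV -/(tab D) -/(tab D').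
  by rewrite /D /D' ex e2 eh; zmod.
have [|N eN] := @obbr_ker L; first by rewrite -eL bdM bdV bd_dif // x1 invg1 mulg1.
rewrite -[x](mulVKg (dif D D')) eL eN; apply: representedM (represented_squares N).
by exists X, (osum n), C, f2, f', i2, i', q, q'.
Qed.

End Final.

Theorem theorem2p2p4 (T : triangulatedCategory) (s : sharp T) (x : K1 s) :
  exists (X Y Z : T) (f f' : arr X Y) (i i' : arr Y Z) (q q' : arr Z (susp X))
         (H : sharp_triangle s (Triangle f i q))
         (H' : sharp_triangle s (Triangle f' i' q')),
    val x = ((tri_class H)^-1 * tri_class H')%g.
Proof.
have [X [Y [Z [f [f' [i [i' [q [q' [H H' e]]]]]]]]]] := ker_represented (eqP (valP x)).
by exists X, Y, Z, f, f', i, i', q, q', H, H'; rewrite e /dif (tclE H) (tclE H').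
Qed.
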